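(* Let $K$ be a field, let $E$ be a finite directed graph, and let $\overline E$ be the graph obtained from $E$ by removing all sources and sinks, repeatedly, until no sources and no sinks remain. Then there is a recollement of abelian categories $$L_K(\overline E)\text{-Mod} \;\longrightarrow\; L_K(E)\text{-Mod} \;\longrightarrow\; \Big(\bigoplus_{\text{sinks}} K\Big)\text{-Mod},$$ that is, a recollement $(\mathscr A,\mathscr B,\mathscr C)$ with $\mathscr A = L_K(\overline E)\text{-Mod}$, $\mathscr B = L_K(E)\text{-Mod}$ and $\mathscr C = \big(\bigoplus_{\text{sinks}} K\big)\text{-Mod}$, where $\bigoplus_{\text{sinks}}K$ is the direct sum of copies of the ring $K$, one for each sink of $E$.
   Context: Graphs. A directed graph $E=(E^0,E^1,r,s)$ consists of a set of vertices $E^0$, a set of edges $E^1$, and maps $r,s:E^1\to E^0$ (range and source). It is finite if $E^0$ and $E^1$ are finite. A vertex $v$ is a sink if $s^{-1}(v)=\emptyset$ and a source if $r^{-1}(v)=\emptyset$. Removing a vertex from a graph means deleting it together with all edges having it as source or range. The removal of sources and sinks is iterated (new sources and sinks may arise after a removal) until the remaining graph, possibly empty, has none; the result does not depend on the order of removal. Leavitt path algebra. For a field $K$ and a finite graph $E$, $L_K(E)$ is the associative $K$-algebra generated by $\{v : v\in E^0\}\cup\{e,e^* : e\in E^1\}$ subject to: $vw=\delta_{v,w}v$ for $v,w\in E^0$; $s(e)e=e=e\,r(e)$ and $r(e)e^*=e^*=e^*s(e)$ for $e\in E^1$; $e^*f=\delta_{e,f}r(e)$ for $e,f\in E^1$;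 and $v=\sum_{e\in s^{-1}(v)}ee^*$ for every vertex $v$ that is not a sink. It is unital with identity $\sum_{v\in E^0}v$ (the zero ring if $E$ is empty). Modules. For a ring $A$ with identity, $A\text{-Mod}$ denotes the category of (unital) left $A$-modules; it is the zero category if $A=0$. Recollement. A recollement of abelian categories $(\mathscr A,\mathscr B,\mathscr C)$ consists of abelian categories $\mathscr A,\mathscr B,\mathscr C$ and six functors $i:\mathscr A\to\mathscr B$, $p,q:\mathscr B\to\mathscr A$, $j:\mathscr B\to\mathscr C$, $r,s:\mathscr C\to\mathscr B$ such that: (i) $(s,j,r)$ and $(q,i,p)$ are adjoint triples, i.e. $s$ is left adjoint to $j$, $j$ is left adjoint to $r$, $q$ is left adjoint to $i$, and $i$ is left adjoint to $p$; (ii) $i$, $s$ and $r$ are fully faithful; (iii) $\operatorname{Im}(i)=\operatorname{Ker}(j)$, where $\operatorname{Im}(i)$ is the essential image of $i$ and $\operatorname{Ker}(j)$ is the full subcategory of objects $X$ with $j(X)\cong0$. *)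

(* Defs.v *)
From HB Require Import structures.
From mathcomp Require Import all_boot all_order all_algebra.
From mathcomp Require boolp.

Set Implicit Arguments.
Unset Strict Implicit.
Unset Printing Implicit Defensive.

Import GRing.Theory.
Local Open Scope ring_scope.

(** * Categories *)

(* Morphisms are compared with Leibniz equality; the category axioms of
   modules below are proved from functional extensionality. *)
Record category := Category {
  obj :> Type;
  hom : obj -> obj -> Type;
  idm : forall X, hom X X;
  mcomp : forall X Y Z, hom Y Z -> hom X Y -> hom X Z;
  mcomp1m : forall X Y (f : hom X Y), mcomp (idm Y) f = f;
  mcompm1 : forall X Y (f : hom X Y), mcomp f (idm X) = f;
  mcompA : forall W X Y Z (h : hom Y Z) (g : hom X Y) (f : hom W X),
    mcomp h (mcomp g f) = mcomp (mcomp h g) f }.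

Arguments hom {c} X Y.
Arguments idm {c} X.
Arguments mcomp {c X Y Z} g f.

Record functor (C D : category) := Functor {
  fobj :> C -> D;
  fmap : forall X Y : C, hom X Y -> hom (fobj X) (fobj Y);
  fmap1 : forall X : C, fmap (idm X) = idm (fobj X);
  fmapM : forall (X Y Z : C) (g : hom Y Z) (f : hom X Y),
    fmap (mcomp g f) = mcomp (fmap g) (fmap f) }.

Arguments fmap {C D} f {X Y} _ : rename.

Definition isomorphic (C : category) (X Y : C) : Prop :=
  exists (f : hom X Y) (g : hom Y X), mcomp g f = idm X /\ mcomp f g = idm Y.

Definition is_initial (C : category) (Z : C) : Prop :=
  forall X : C, exists! f : hom Z X, True.

Definition is_terminal (C : category) (Z : C) : Prop :=
  forall X : C, exists! f : hom X Z, True.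

Definition zero_object (C : category) (Z : C) : Prop :=
  is_initial Z /\ is_terminal Z.

Definition zero_morphism (C : category) (X Y : C) (f : hom X Y) : Prop :=
  exists Z : C, zero_object Z /\
    exists (g : hom X Z) (h : hom Z Y), f = mcomp h g.

Definition monomorphism (C : category) (X Y : C) (f : hom X Y) : Prop :=
  forall (W : C) (g h : hom W X), mcomp f g = mcomp f h -> g = h.

Definition epimorphism (C : category) (X Y : C) (f : hom X Y) : Prop :=
  forall (W : C) (g h : hom Y W), mcomp g f = mcomp h f -> g = h.

Definition is_product (C : category) (X Y P : C)
    (p1 : hom P X) (p2 : hom P Y) : Prop :=
  forall (W : C) (f : hom W X) (g : hom W Y),
    exists! u : hom W P, mcomp p1 u = f /\ mcomp p2 u = g.

Definition is_coproduct (C : category) (X Y S : C)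
    (i1 : hom X S) (i2 : hom Y S) : Prop :=
  forall (W : C) (f : hom X W) (g : hom Y W),
    exists! u : hom S W, mcomp u i1 = f /\ mcomp u i2 = g.

Definition is_kernel (C : category) (X Y N : C)
    (f : hom X Y) (k : hom N X) : Prop :=
  zero_morphism (mcomp f k) /\
  forall (W : C) (g : hom W X), zero_morphism (mcomp f g) ->
    exists! u : hom W N, mcomp k u = g.

Definition is_cokernel (C : category) (X Y Q : C)
    (f : hom X Y) (c : hom Y Q) : Prop :=
  zero_morphism (mcomp c f) /\
  forall (W : C) (g : hom Y W), zero_morphism (mcomp g f) ->
    exists! u : hom Q W, mcomp u c = g.

(* Freyd's axioms for abelian categories; the additive structure on the
   hom-sets is not a datum, as these axioms determine it uniquely. *)
Record abelian (C : category) : Prop := Abelian {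
  ab_zero : exists Z : C, zero_object Z;
  ab_product : forall X Y : C,
    exists (P : C) (p1 : hom P X) (p2 : hom P Y), is_product p1 p2;
  ab_coproduct : forall X Y : C,
    exists (S : C) (i1 : hom X S) (i2 : hom Y S), is_coproduct i1 i2;
  ab_kernel : forall (X Y : C) (f : hom X Y),
    exists (N : C) (k : hom N X), is_kernel f k;
  ab_cokernel : forall (X Y : C) (f : hom X Y),
    exists (Q : C) (c : hom Y Q), is_cokernel f c;
  ab_normal : forall (X Y : C) (f : hom X Y), monomorphism f ->
    exists (Z : C) (g : hom Y Z), is_kernel g f;
  ab_conormal : forall (X Y : C) (f : hom X Y), epimorphism f ->
    exists (Z : C) (g : hom Z X), is_cokernel g f }.

(** * Recollements *)

Definition left_adjoint (C D : category) (F : functor C D) (G : functor D C)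
    : Prop :=
  exists phi : forall (X : C) (Y : D), hom (F X) Y -> hom X (G Y),
    (forall X Y, bijective (@phi X Y)) /\
    (forall (X X' : C) (Y Y' : D)
            (a : hom X' X) (b : hom Y Y') (f : hom (F X) Y),
      phi X' Y' (mcomp b (mcomp f (fmap F a)))
      = mcomp (fmap G b) (mcomp (phi X Y f) a)).

Definition fully_faithful (C D : category) (F : functor C D) : Prop :=
  forall X Y : C, bijective (@fmap C D F X Y).

Definition essential_image (C D : category) (F : functor C D) (Y : D) : Prop :=
  exists X : C, isomorphic (F X) Y.

Definition functor_kernel (C D : category) (F : functor C D) (X : C) : Prop :=
  exists Z : D, zero_object Z /\ isomorphic (F X) Z.

Record recollement (A B C : category) := Recollement {
  rec_i : functor A B;
  rec_p : functor B A;
  rec_q : functor B A;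
  rec_j : functor B C;
  rec_r : functor C B;
  rec_s : functor C B;
  rec_abA : abelian A;
  rec_abB : abelian B;
  rec_abC : abelian C;
  rec_adj_sj : left_adjoint rec_s rec_j;
  rec_adj_jr : left_adjoint rec_j rec_r;
  rec_adj_qi : left_adjoint rec_q rec_i;
  rec_adj_ip : left_adjoint rec_i rec_p;
  rec_ff_i : fully_faithful rec_i;
  rec_ff_s : fully_faithful rec_s;
  rec_ff_r : fully_faithful rec_r;
  rec_im_ker : forall X : B,
    essential_image rec_i X <-> functor_kernel rec_j X }.

(** * Categories of modules *)

Lemma linear_funext (A : pzRingType) (M N : lmodType A) (f g : {linear M -> N}) :
  f =1 g -> f = g.
Proof.
case: f g => [f [[a] [b]]] [g [[c] [d]]] /= fg.
have {}fg : f = g by apply/boolp.funext.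
case: g / fg in c d *.
congr (GRing.Linear.Pack (GRing.Linear.Class _ _)).
- by congr GRing.isNmodMorphism.Axioms_; apply: boolp.Prop_irrelevance.
- by congr GRing.isScalable.Axioms_; apply: boolp.Prop_irrelevance.
Qed.

Lemma linear_comp1m (A : pzRingType) (M N : lmodType A) (f : {linear M -> N}) :
  (idfun \o f : {linear M -> N}) = f.
Proof. exact: linear_funext. Qed.

Lemma linear_compm1 (A : pzRingType) (M N : lmodType A) (f : {linear M -> N}) :
  (f \o idfun : {linear M -> N}) = f.
Proof. exact: linear_funext. Qed.

Lemma linear_compA (A : pzRingType) (M N P Q : lmodType A)
    (h : {linear P -> Q}) (g : {linear N -> P}) (f : {linear M -> N}) :
  (h \o (g \o f) : {linear M -> Q}) = ((h \o g) \o f : {linear M -> Q}).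
Proof. exact: linear_funext. Qed.

(* [pzRingType] allows the zero ring, whose modules are all trivial. The
   carrier of an [lmodType] has decidable equality and a choice operator, which
   classically is no restriction. *)
Definition Mod (A : pzRingType) : category :=
  @Category (lmodType A) (fun M N => {linear M -> N})
    (fun M => idfun : {linear M -> M})
    (fun M N P (g : {linear N -> P}) (f : {linear M -> N}) =>
       (g \o f : {linear M -> P}))
    (@linear_comp1m A) (@linear_compm1 A) (@linear_compA A).

(** * Finite directed graphs *)

Record digraph := Digraph {
  vertex : finType;
  edge : finType;
  src : edge -> vertex;
  rng : edge -> vertex }.

Arguments src {d} e.
Arguments rng {d} e.

Definition is_sink (E : digraph) (v : vertex E) : bool :=
  [forall e : edge E, src e != v].

Definition is_source (E : digraph) (v : vertex E) : bool :=
  [forall e : edge E, rng e != v].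

Definition sinks (E : digraph) : finType := {v : vertex E | is_sink v}.

(* The graph left after removing the vertices outside [X]. *)
Definition induced (E : digraph) (X : {set vertex E}) : digraph :=
  @Digraph {v : vertex E | v \in X}
    {e : edge E | (src e \in X) && (rng e \in X)}
    (fun e => exist _ (src (val e)) (proj1 (andP (valP e))))
    (fun e => exist _ (rng (val e)) (proj2 (andP (valP e)))).

(* The vertices of [induced X] that are neither sinks nor sources of it. *)
Definition prune (E : digraph) (X : {set vertex E}) : {set vertex E} :=
  [set val v | v : vertex (induced X) & ~~ is_sink v && ~~ is_source v].

(* [#|vertex E|] rounds suffice for the removal to terminate, see
   [core_no_sink] and [core_no_source]. *)
Definition core_vertices (E : digraph) : {set vertex E} :=
  iter #|vertex E| (@prune E) setT.

Definition core (E : digraph) : digraph := induced (core_vertices E).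

Lemma prune_sub (E : digraph) (X : {set vertex E}) : prune X \subset X.
Proof. by apply/subsetP => _ /imsetP[v _ ->]; exact: valP v. Qed.

Lemma prune_core (E : digraph) : prune (core_vertices E) = core_vertices E.
Proof.
have H n : prune (iter n (@prune E) setT) = iter n (@prune E) setT \/
    (n + #|iter n (@prune E) setT| <= #|vertex E|)%N.
  elim: n => [|n [IH|IH]]; first by right; rewrite add0n max_card.
    by left; rewrite /= !IH.
  have := prune_sub (iter n (@prune E) setT).
  rewrite subEproper => /orP[/eqP e|/proper_card lt].
    by left; rewrite /= !e.
  by right; apply: leq_trans IH; rewrite /= addSn -addnS leq_add2l.
have [//|] := H #|vertex E|; rewrite -[leqRHS]addn0 leq_add2l leqn0 cards_eq0.
move=> /eqP X0; apply/eqP.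
by rewrite /core_vertices X0 -subset0 prune_sub.
Qed.

Lemma core_no_sink_source (E : digraph) (v : vertex (core E)) :
  ~~ is_sink v && ~~ is_source v.
Proof.
have : val v \in prune (core_vertices E) by rewrite prune_core; exact: valP.
by move=> /imsetP[w + /val_inj ->]; rewrite inE.
Qed.

Lemma core_no_sink (E : digraph) (v : vertex (core E)) : ~~ is_sink v.
Proof. by case/andP: (core_no_sink_source v). Qed.

Lemma core_no_source (E : digraph) (v : vertex (core E)) : ~~ is_source v.
Proof. by case/andP: (core_no_sink_source v). Qed.

(** * Leavitt path algebras *)

(* Formal (not necessarily unital) K-algebra expressions in the generators. *)
Inductive lpa_term (K : fieldType) (E : digraph) : Type :=
| LVertex of vertex E
| LEdge of edge E
| LGhost of edge E
| LZero
| LAdd of lpa_term K E & lpa_term K E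
| LOpp of lpa_term K E
| LMul of lpa_term K E & lpa_term K E
| LScale of K & lpa_term K E.

Arguments LVertex {K E} _.
Arguments LEdge {K E} _.
Arguments LGhost {K E} _.
Arguments LZero {K E}.

(* The congruence generated by the axioms of associative K-algebras and the
   defining relations. *)
Inductive lpa_eq (K : fieldType) (E : digraph) :
    lpa_term K E -> lpa_term K E -> Prop :=
| lpa_refl x : lpa_eq x x
| lpa_sym x y : lpa_eq x y -> lpa_eq y x
| lpa_trans x y z : lpa_eq x y -> lpa_eq y z -> lpa_eq x z
| lpa_congD x x' y y' :
    lpa_eq x x' -> lpa_eq y y' -> lpa_eq (LAdd x y) (LAdd x' y')
| lpa_congN x x' : lpa_eq x x' -> lpa_eq (LOpp x) (LOpp x')
| lpa_congM x x' y y' :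
    lpa_eq x x' -> lpa_eq y y' -> lpa_eq (LMul x y) (LMul x' y')
| lpa_congZ k x x' : lpa_eq x x' -> lpa_eq (LScale k x) (LScale k x')
| lpa_addA x y z : lpa_eq (LAdd x (LAdd y z)) (LAdd (LAdd x y) z)
| lpa_addC x y : lpa_eq (LAdd x y) (LAdd y x)
| lpa_add0 x : lpa_eq (LAdd LZero x) x
| lpa_addN x : lpa_eq (LAdd (LOpp x) x) LZero
| lpa_mulA x y z : lpa_eq (LMul x (LMul y z)) (LMul (LMul x y) z)
| lpa_mulDl x y z :
    lpa_eq (LMul (LAdd x y) z) (LAdd (LMul x z) (LMul y z))
| lpa_mulDr x y z :
    lpa_eq (LMul x (LAdd y z)) (LAdd (LMul x y) (LMul x z))
| lpa_scaleA a b x : lpa_eq (LScale a (LScale b x)) (LScale (a * b) x)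
| lpa_scale1 x : lpa_eq (LScale 1 x) x
| lpa_scaleDr a x y :
    lpa_eq (LScale a (LAdd x y)) (LAdd (LScale a x) (LScale a y))
| lpa_scaleDl a b x :
    lpa_eq (LScale (a + b) x) (LAdd (LScale a x) (LScale b x))
| lpa_scaleAl a x y : lpa_eq (LScale a (LMul x y)) (LMul (LScale a x) y)
| lpa_scaleAr a x y : lpa_eq (LScale a (LMul x y)) (LMul x (LScale a y))
| lpa_vertexM (v w : vertex E) :
    lpa_eq (LMul (LVertex v) (LVertex w)) (if v == w then LVertex v else LZero)
| lpa_src_edge (e : edge E) :
    lpa_eq (LMul (LVertex (src e)) (LEdge e)) (LEdge e)
| lpa_edge_rng (e : edge E) :
    lpa_eq (LMul (LEdge e) (LVertex (rng e))) (LEdge e)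
| lpa_rng_ghost (e : edge E) :
    lpa_eq (LMul (LVertex (rng e)) (LGhost e)) (LGhost e)
| lpa_ghost_src (e : edge E) :
    lpa_eq (LMul (LGhost e) (LVertex (src e))) (LGhost e)
| lpa_ghostM (e f : edge E) :
    lpa_eq (LMul (LGhost e) (LEdge f))
           (if e == f then LVertex (rng e) else LZero)
| lpa_cuntz_krieger (v : vertex E) : ~~ is_sink v ->
    lpa_eq (LVertex v)
           (\big[@LAdd K E/LZero]_(e : edge E | src e == v)
              LMul (LEdge e) (LGhost e)).

HB.instance Definition _ (K : fieldType) (E : digraph) :=
  boolp.gen_eqMixin (lpa_term K E).
HB.instance Definition _ (K : fieldType) (E : digraph) :=
  boolp.gen_choiceMixin (lpa_term K E).

Definition lpa_eqb (K : fieldType) (E : digraph) (x y : lpa_term K E) : bool :=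
  boolp.asbool (lpa_eq x y).

Lemma lpa_eqb_refl (K : fieldType) (E : digraph) : reflexive (@lpa_eqb K E).
Proof. by move=> x; apply/boolp.asboolP; exact: lpa_refl. Qed.

Lemma lpa_eqb_sym (K : fieldType) (E : digraph) : symmetric (@lpa_eqb K E).
Proof.
by move=> x y; apply/boolp.asboolP/boolp.asboolP; exact: lpa_sym.
Qed.

Lemma lpa_eqb_trans (K : fieldType) (E : digraph) : transitive (@lpa_eqb K E).
Proof.
move=> y x z /boolp.asboolP xy /boolp.asboolP yz.
by apply/boolp.asboolP; exact: lpa_trans xy yz.
Qed.

Canonical lpa_equiv (K : fieldType) (E : digraph) :=
  EquivRel (@lpa_eqb K E) (@lpa_eqb_refl K E) (@lpa_eqb_sym K E)
    (@lpa_eqb_trans K E).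

Local Open Scope quotient_scope.

Definition lpa (K : fieldType) (E : digraph) := {eq_quot (@lpa_equiv K E)}.

HB.instance Definition _ (K : fieldType) (E : digraph) := Choice.on (lpa K E).

Definition lpa_pi (K : fieldType) (E : digraph) (x : lpa_term K E) : lpa K E :=
  \pi_({eq_quot (@lpa_equiv K E)}) x.

Definition lpa_repr (K : fieldType) (E : digraph) (x : lpa K E) :
    lpa_term K E := repr (x : {eq_quot (@lpa_equiv K E)}).

Lemma lpa_reprK (K : fieldType) (E : digraph) :
  cancel (@lpa_repr K E) (@lpa_pi K E).
Proof. by move=> x; exact: reprK. Qed.

Lemma lpa_piP (K : fieldType) (E : digraph) (x y : lpa_term K E) :
  lpa_pi x = lpa_pi y <-> lpa_eq x y.
Proof.
by split=> [/eqmodP /boolp.asboolP //|xy]; apply/eqmodP/boolp.asboolP.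
Qed.

Lemma lpa_piK (K : fieldType) (E : digraph) (x : lpa_term K E) :
  lpa_eq (lpa_repr (lpa_pi x)) x.
Proof. by apply/lpa_piP; rewrite lpa_reprK. Qed.

Lemma lpa_ind (K : fieldType) (E : digraph) (P : lpa K E -> Prop) :
  (forall x, P (lpa_pi x)) -> forall x, P x.
Proof. by move=> Ppi x; rewrite -(lpa_reprK x). Qed.

Definition lpa_zero (K : fieldType) (E : digraph) : lpa K E := lpa_pi LZero.
Definition lpa_add (K : fieldType) (E : digraph) (x y : lpa K E) : lpa K E :=
  lpa_pi (LAdd (lpa_repr x) (lpa_repr y)).
Definition lpa_opp (K : fieldType) (E : digraph) (x : lpa K E) : lpa K E :=
  lpa_pi (LOpp (lpa_repr x)).
Definition lpa_mul (K : fieldType) (E : digraph) (x y : lpa K E) : lpa K E :=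
  lpa_pi (LMul (lpa_repr x) (lpa_repr y)).
Definition lpa_scale (K : fieldType) (E : digraph) (k : K) (x : lpa K E) :
    lpa K E := lpa_pi (LScale k (lpa_repr x)).
Definition lpa_one (K : fieldType) (E : digraph) : lpa K E :=
  lpa_pi (\big[@LAdd K E/LZero]_(v : vertex E) LVertex v).

Lemma lpa_piD (K : fieldType) (E : digraph) (x y : lpa_term K E) :
  lpa_add (lpa_pi x) (lpa_pi y) = lpa_pi (LAdd x y).
Proof. by apply/lpa_piP; apply: lpa_congD; exact: lpa_piK. Qed.

Lemma lpa_piN (K : fieldType) (E : digraph) (x : lpa_term K E) :
  lpa_opp (lpa_pi x) = lpa_pi (LOpp x).
Proof. by apply/lpa_piP; apply: lpa_congN; exact: lpa_piK. Qed.

Lemma lpa_piM (K : fieldType) (E : digraph) (x y : lpa_term K E) :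
  lpa_mul (lpa_pi x) (lpa_pi y) = lpa_pi (LMul x y).
Proof. by apply/lpa_piP; apply: lpa_congM; exact: lpa_piK. Qed.

Lemma lpa_piZ (K : fieldType) (E : digraph) (k : K) (x : lpa_term K E) :
  lpa_scale k (lpa_pi x) = lpa_pi (LScale k x).
Proof. by apply/lpa_piP; apply: lpa_congZ; exact: lpa_piK. Qed.

Lemma lpa_zmod_addA (K : fieldType) (E : digraph) : associative (@lpa_add K E).
Proof.
elim/lpa_ind=> x; elim/lpa_ind=> y; elim/lpa_ind=> z.
by rewrite !lpa_piD; apply/lpa_piP; exact: lpa_addA.
Qed.

Lemma lpa_zmod_addC (K : fieldType) (E : digraph) : commutative (@lpa_add K E).
Proof.
elim/lpa_ind=> x; elim/lpa_ind=> y.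
by rewrite !lpa_piD; apply/lpa_piP; exact: lpa_addC.
Qed.

Lemma lpa_zmod_add0 (K : fieldType) (E : digraph) :
  left_id (lpa_zero K E) (@lpa_add K E).
Proof.
by elim/lpa_ind=> x; rewrite !lpa_piD; apply/lpa_piP; exact: lpa_add0.
Qed.

Lemma lpa_zmod_addN (K : fieldType) (E : digraph) :
  left_inverse (lpa_zero K E) (@lpa_opp K E) (@lpa_add K E).
Proof.
elim/lpa_ind=> x; rewrite lpa_piN lpa_piD; apply/lpa_piP; exact: lpa_addN.
Qed.

HB.instance Definition _ (K : fieldType) (E : digraph) :=
  GRing.isZmodule.Build (lpa K E) (@lpa_zmod_addA K E) (@lpa_zmod_addC K E)
    (@lpa_zmod_add0 K E) (@lpa_zmod_addN K E).

Lemma lpa_ring_mulA (K : fieldType) (E : digraph) : associative (@lpa_mul K E).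
Proof.
elim/lpa_ind=> x; elim/lpa_ind=> y; elim/lpa_ind=> z.
by rewrite !lpa_piM; apply/lpa_piP; exact: lpa_mulA.
Qed.

Lemma lpa_ring_mulDl (K : fieldType) (E : digraph) :
  left_distributive (@lpa_mul K E) +%R.
Proof.
elim/lpa_ind=> x; elim/lpa_ind=> y; elim/lpa_ind=> z.
rewrite /GRing.add /= !(lpa_piM, lpa_piD).
by apply/lpa_piP; exact: lpa_mulDl.
Qed.

Lemma lpa_ring_mulDr (K : fieldType) (E : digraph) :
  right_distributive (@lpa_mul K E) +%R.
Proof.
elim/lpa_ind=> x; elim/lpa_ind=> y; elim/lpa_ind=> z.
rewrite /GRing.add /= !(lpa_piM, lpa_piD).
by apply/lpa_piP; exact: lpa_mulDr.
Qed.

Lemma lpa_ring_mul0l (K : fieldType) (E : digraph) (x : lpa K E) :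
  lpa_mul 0 x = 0.
Proof. by apply: (addrI (lpa_mul 0 x)); rewrite -lpa_ring_mulDl !addr0. Qed.

Lemma lpa_ring_mul0r (K : fieldType) (E : digraph) (x : lpa K E) :
  lpa_mul x 0 = 0.
Proof. by apply: (addrI (lpa_mul x 0)); rewrite -lpa_ring_mulDr !addr0. Qed.

Lemma lpa_oneE (K : fieldType) (E : digraph) :
  lpa_one K E = \sum_(v : vertex E) lpa_pi (LVertex v).
Proof.
apply: (big_morph (@lpa_pi K E)) => // x y.
by rewrite -lpa_piD.
Qed.

Lemma lpa_vertex_mul (K : fieldType) (E : digraph) (v w : vertex E) :
  lpa_mul (lpa_pi (LVertex v)) (lpa_pi (LVertex w))
  = if v == w then lpa_pi (LVertex v) else 0 :> lpa K E.
Proof.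
rewrite lpa_piM (_ : 0 = lpa_pi LZero) // -fun_if.
by apply/lpa_piP; exact: lpa_vertexM.
Qed.

Lemma lpa_one_mull (K : fieldType) (E : digraph) (w : vertex E) (x : lpa K E) :
  lpa_mul (lpa_pi (LVertex w)) x = x -> lpa_mul (lpa_one K E) x = x.
Proof.
move=> wx; rewrite lpa_oneE.
rewrite (big_morph (fun a => lpa_mul a x) (fun a b => lpa_ring_mulDl a b x)
  (lpa_ring_mul0l x)).
rewrite (bigD1 w) //= wx big1 ?addr0 // => v /negPf vw.
by rewrite -wx lpa_ring_mulA lpa_vertex_mul vw lpa_ring_mul0l.
Qed.

Lemma lpa_one_mulr (K : fieldType) (E : digraph) (w : vertex E) (x : lpa K E) :
  lpa_mul x (lpa_pi (LVertex w)) = x -> lpa_mul x (lpa_one K E) = x.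
Proof.
move=> xw; rewrite lpa_oneE.
rewrite (big_morph (lpa_mul x) (lpa_ring_mulDr x) (lpa_ring_mul0r x)).
rewrite (bigD1 w) //= xw big1 ?addr0 // => v; rewrite eq_sym => /negPf vw.
by rewrite -xw -lpa_ring_mulA lpa_vertex_mul vw lpa_ring_mul0r.
Qed.

Lemma lpa_mul_scalel (K : fieldType) (E : digraph) (a : K) (x y : lpa K E) :
  lpa_scale a (lpa_mul x y) = lpa_mul (lpa_scale a x) y.
Proof.
elim/lpa_ind: x => x; elim/lpa_ind: y => y.
by rewrite !(lpa_piM, lpa_piZ); apply/lpa_piP; exact: lpa_scaleAl.
Qed.

Lemma lpa_mul_scaler (K : fieldType) (E : digraph) (a : K) (x y : lpa K E) :
  lpa_scale a (lpa_mul x y) = lpa_mul x (lpa_scale a y).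
Proof.
elim/lpa_ind: x => x; elim/lpa_ind: y => y.
by rewrite !(lpa_piM, lpa_piZ); apply/lpa_piP; exact: lpa_scaleAr.
Qed.

Lemma lpa_ring_mul1 (K : fieldType) (E : digraph) :
  left_id (lpa_one K E) (@lpa_mul K E).
Proof.
elim/lpa_ind; elim=> [v|e|e||x IHx y IHy|x IHx|x IHx y IHy|k x IHx].
- by apply: (@lpa_one_mull _ _ v); rewrite lpa_vertex_mul eqxx.
- apply: (@lpa_one_mull _ _ (src e)); rewrite lpa_piM.
  by apply/lpa_piP; exact: lpa_src_edge.
- apply: (@lpa_one_mull _ _ (rng e)); rewrite lpa_piM.
  by apply/lpa_piP; exact: lpa_rng_ghost.
- exact: lpa_ring_mul0r.
- by rewrite -lpa_piD lpa_ring_mulDr IHx IHy.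
- rewrite -lpa_piN; apply: (addrI (lpa_pi x)); rewrite -{1}IHx.
  by rewrite -lpa_ring_mulDr (@addrN (lpa K E)) lpa_ring_mul0r.
- by rewrite -lpa_piM lpa_ring_mulA IHx.
- by rewrite -lpa_piZ -lpa_mul_scaler IHx.
Qed.

Lemma lpa_ring_mulr1 (K : fieldType) (E : digraph) :
  right_id (lpa_one K E) (@lpa_mul K E).
Proof.
elim/lpa_ind; elim=> [v|e|e||x IHx y IHy|x IHx|x IHx y IHy|k x IHx].
- by apply: (@lpa_one_mulr _ _ v); rewrite lpa_vertex_mul eqxx.
- apply: (@lpa_one_mulr _ _ (rng e)); rewrite lpa_piM.
  by apply/lpa_piP; exact: lpa_edge_rng.
- apply: (@lpa_one_mulr _ _ (src e)); rewrite lpa_piM.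
  by apply/lpa_piP; exact: lpa_ghost_src.
- exact: lpa_ring_mul0l.
- by rewrite -lpa_piD lpa_ring_mulDl IHx IHy.
- rewrite -lpa_piN; apply: (addrI (lpa_pi x)); rewrite -{1}IHx.
  by rewrite -lpa_ring_mulDl (@addrN (lpa K E)) lpa_ring_mul0l.
- by rewrite -lpa_piM -lpa_ring_mulA IHy.
- by rewrite -lpa_piZ -lpa_mul_scalel IHx.
Qed.

HB.instance Definition _ (K : fieldType) (E : digraph) :=
  GRing.Zmodule_isPzRing.Build (lpa K E) (@lpa_ring_mulA K E)
    (@lpa_ring_mul1 K E) (@lpa_ring_mulr1 K E)
    (@lpa_ring_mulDl K E) (@lpa_ring_mulDr K E).

Lemma lpa_lmod_scaleA (K : fieldType) (E : digraph) (a b : K) (x : lpa K E) :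
  lpa_scale a (lpa_scale b x) = lpa_scale (a * b) x.
Proof.
by elim/lpa_ind: x => x; rewrite !lpa_piZ; apply/lpa_piP; exact: lpa_scaleA.
Qed.

Lemma lpa_lmod_scale1 (K : fieldType) (E : digraph) :
  left_id 1 (@lpa_scale K E).
Proof.
by elim/lpa_ind=> x; rewrite lpa_piZ; apply/lpa_piP; exact: lpa_scale1.
Qed.

Lemma lpa_lmod_scaleDr (K : fieldType) (E : digraph) :
  right_distributive (@lpa_scale K E) +%R.
Proof.
move=> a; elim/lpa_ind=> x; elim/lpa_ind=> y.
rewrite /GRing.add /= !(lpa_piZ, lpa_piD).
by apply/lpa_piP; exact: lpa_scaleDr.
Qed.

Lemma lpa_lmod_scaleDl (K : fieldType) (E : digraph) (x : lpa K E) :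
  {morph (@lpa_scale K E)^~ x : a b / a + b}.
Proof.
elim/lpa_ind: x => x a b; rewrite !lpa_piZ.
rewrite [RHS]lpa_piD; apply/lpa_piP; exact: lpa_scaleDl.
Qed.

HB.instance Definition _ (K : fieldType) (E : digraph) :=
  GRing.Zmodule_isLmodule.Build K (lpa K E) (@lpa_lmod_scaleA K E)
    (@lpa_lmod_scale1 K E) (@lpa_lmod_scaleDr K E) (@lpa_lmod_scaleDl K E).

(* The library's algebra structures exclude the zero ring, so the remaining
   axioms of a K-algebra are stated as lemmas. *)
Lemma lpa_scalerAl (K : fieldType) (E : digraph) (a : K) (x y : lpa K E) :
  a *: (x * y) = (a *: x) * y.
Proof. exact: lpa_mul_scalel. Qed.

Lemma lpa_scalerAr (K : fieldType) (E : digraph) (a : K) (x y : lpa K E) :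
  a *: (x * y) = x * (a *: y).
Proof. exact: lpa_mul_scaler. Qed.

(* Main.v *)
(* Let e be the sum of the sinks of E. The recollement is the one attached to the
   idempotent e of L = L_K(E): j sends M to eM, a module over eLe, which is the
   product of copies of K indexed by the sinks, and the kernel of j consists of
   the modules on which the sinks act as zero.

   On such a module every vertex removed by repeatedly eliminating sinks acts as
   zero, and every other vertex outside the core can be written, by the
   Cuntz-Krieger relation, through paths ending in the core; so the module is
   determined by its core part, an L_K(core E)-module.

   All the embeddings into L-Mod are modules of functions on the paths leading to
   a set T of vertices: for T the set of sinks, all functions give the right
   adjoint r of j and the finitely supported ones the left adjoint s; for T the
   core they give i. Then p takes the core part of the largest submodule
   killed by the sinks, and q that of the largest quotient killed by the sinks. *)

Require Import Defs.
From HB Require Import structures.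
From mathcomp Require Import all_boot all_order all_algebra.
From mathcomp Require Import boolp functions.

Set Implicit Arguments.
Unset Strict Implicit.
Unset Printing Implicit Defensive.

Import GRing.Theory.
Import Defs.
Local Open Scope ring_scope.

(** The removal alternates between sources and sinks, so the core is used through a description free
    of any order: it is the largest vertex set in which each vertex has an in-edge and an out-edge
    within the set ([sub_core]). Two consequences carry the argument. An edge leaving the core ends
    in a dead vertex ([core_exit]), so on a module killed by the sinks the core edges alone satisfy
    the relations of L_K(core E). And no cycle lies outside the core, which gives an induction
    against the direction of the edges ([core_ind]).

    L_K(E) enters through its universal property: a module is an abelian group with operators
    satisfying the relations. The record [corner_data] collects what the path construction asks of
    the ring acting at the ends of the paths, so that sinks and core are treated at once. The part
    of a path module at [T] sits on the empty path; this makes the relevant units and counits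
    invertible, whence full faithfulness. For the core the paths have bounded length, so finite
    support is automatic; the flag is set there because maps out of a path module are built as
    finite sums. *)

Lemma inj_surj_bijective (S T : Type) (f : S -> T) :
  injective f -> (forall y, exists x, f x = y) -> bijective f.
Proof.
by move=> fI /choice[g gK]; exists g => // x; apply: fI; rewrite gK.
Qed.

Definition mklin (A : pzRingType) (M N : lmodType A) (f : M -> N)
    (fl : linear f) : {linear M -> N} :=
  HB.pack f (GRing.isLinear.Build A M N *:%R f fl).

Lemma linear_eq (A : pzRingType) (M N : lmodType A) (f g : {linear M -> N}) :
  f = g -> f =1 g.
Proof. by move=> ->. Qed.

(** * Submodules and quotient modules *)

Record subgroup (M : zmodType) := Subgroup {
  in_subgroup :> M -> Prop;
  subgroup0 : in_subgroup 0;
  subgroupB : forall x y, in_subgroup x -> in_subgroup y ->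
    in_subgroup (x - y) }.

Record submodule (A : pzRingType) (M : lmodType A) := Submodule {
  submodule_subgroup :> subgroup M;
  submoduleZ : forall a x, submodule_subgroup x ->
    submodule_subgroup (a *: x) }.

Section SubgroupType.
Variables (M : zmodType) (U : subgroup M).

(** Membership is a proposition, since images and spans are given by existential or impredicative
    formulas; [asbool] makes it a boolean predicate. *)
Definition subg := {x : M | `[< U x >]}.

HB.instance Definition _ := SubType.on subg.
HB.instance Definition _ := Choice.on subg.

Lemma subg_zmod_closed : zmod_closed (fun x => `[< U x >]).
Proof.
split=> [|x y]; rewrite -!topredE /= !asboolE; first exact: subgroup0.
exact: subgroupB.
Qed.

HB.instance Definition _ :=
  GRing.SubChoice_isSubZmodule.Build M (fun x => `[< U x >]) subg
    subg_zmod_closed.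

Definition mksub (x : M) (Ux : U x) : subg := exist _ x (asboolT Ux).

Lemma subgP (x : subg) : U (val x).
Proof. exact: asboolW (valP x). Qed.

End SubgroupType.

Section SubmoduleType.
Variables (A : pzRingType) (M : lmodType A) (U : submodule M).

Definition subm := subg U.

HB.instance Definition _ := GRing.SubZmodule.on subm.

Lemma subm_subsemimod_closed : subsemimod_closed (fun x => `[< U x >]).
Proof.
apply: GRing.submod_closed_semi; split=> [|a x y]; rewrite -!topredE /= !asboolE.
  exact: subgroup0.
move=> Ux Uy; rewrite -[y]opprK; apply: subgroupB; first exact: submoduleZ.
by rewrite -scaleN1r; exact: submoduleZ.
Qed.

HB.instance Definition _ :=
  GRing.SubZmodule_isSubLmodule.Build A M (fun x => `[< U x >]) subm
    subm_subsemimod_closed.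

Definition subm_val : {linear subm -> M} := val.

End SubmoduleType.

Section QuotientModule.
Variables (A : pzRingType) (M : lmodType A) (U : submodule M).
Local Open Scope quotient_scope.

Definition quom_pred : pred M := fun x => `[< U x >].

Definition quom_closed : zmodClosed M := HB.pack_for (zmodClosed M) quom_pred
  (GRing.isZmodClosed.Build M quom_pred (subg_zmod_closed U)).

Definition quom := Quotient.quot quom_closed.
HB.instance Definition _ := GRing.Zmodule.on quom.

Definition quom_pi (x : M) : quom := \pi_(Quotient.quot quom_closed) x.

Lemma quom_pi_eq (x y : M) : quom_pi x = quom_pi y <-> U (x - y).
Proof.
split=> [/eqmodP|Uxy]; first by move/asboolP.
by apply/eqmodP; apply/asboolP.
Qed.

Lemma quom_pi_surj (y : quom) : exists x, quom_pi x = y.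
Proof. by exists (repr (y : Quotient.quot quom_closed)); exact: reprK. Qed.

Lemma quom_piB : zmod_morphism quom_pi.
Proof. exact: pi_is_zmod_morphism. Qed.

Definition quom_scale (a : A) (y : quom) : quom :=
  quom_pi (a *: repr (y : Quotient.quot quom_closed)).

Lemma quom_scaleE a x : quom_scale a (quom_pi x) = quom_pi (a *: x).
Proof.
apply/quom_pi_eq; rewrite -scalerBr; apply: submoduleZ.
by apply/quom_pi_eq; exact: reprK.
Qed.

HB.instance Definition _ := GRing.isZmodMorphism.Build M quom quom_pi quom_piB.

Lemma quom_scaleA a b y : quom_scale a (quom_scale b y) = quom_scale (a * b) y.
Proof. by have [x <-] := quom_pi_surj y; rewrite !quom_scaleE scalerA. Qed.

Lemma quom_scale1 : left_id 1 quom_scale.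
Proof.
by move=> y; have [x <-] := quom_pi_surj y; rewrite quom_scaleE scale1r.
Qed.

Lemma quom_scaleDr : right_distributive quom_scale +%R.
Proof.
move=> a y z; have [x <-] := quom_pi_surj y; have [x' <-] := quom_pi_surj z.
by rewrite -raddfD !quom_scaleE scalerDr raddfD.
Qed.

Lemma quom_scaleDl y : {morph quom_scale^~ y : a b / a + b}.
Proof.
move=> a b; have [x <-] := quom_pi_surj y.
by rewrite !quom_scaleE scalerDl raddfD.
Qed.

HB.instance Definition _ := GRing.Zmodule_isLmodule.Build A quom
  quom_scaleA quom_scale1 quom_scaleDr quom_scaleDl.

Lemma quom_pi_scalable : scalable quom_pi.
Proof. by move=> a x; rewrite -quom_scaleE. Qed.

HB.instance Definition _ := GRing.isScalable.Build A M quom *:%R quom_pi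
  quom_pi_scalable.

Definition quom_proj : {linear M -> quom} := quom_pi.

Lemma quom_pi_eq0 x : quom_pi x = 0 <-> U x.
Proof.
have -> : 0 = quom_pi 0 by rewrite raddf0.
by rewrite quom_pi_eq subr0.
Qed.

Section Lift.
Variables (N : lmodType A) (f : {linear M -> N}).
Hypothesis fU : forall x, U x -> f x = 0.

Definition quom_lift (y : quom) : N := f (repr (y : Quotient.quot quom_closed)).

Lemma quom_liftE x : quom_lift (quom_pi x) = f x.
Proof.
apply/eqP; rewrite -subr_eq0 -raddfB; apply/eqP; apply: fU.
by apply/quom_pi_eq; exact: reprK.
Qed.

Lemma quom_lift_linear : linear quom_lift.
Proof.
move=> a y z; have [x <-] := quom_pi_surj y; have [x' <-] := quom_pi_surj z.
by rewrite -linearP !quom_liftE linearP.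
Qed.

Definition quom_lin : {linear quom -> N} := mklin quom_lift_linear.
End Lift.

End QuotientModule.

Section LinearSub.
Variables (A : pzRingType) (M N : lmodType A) (f : {linear M -> N}).

Section Factor.
Variables (U : submodule N).
Hypothesis fU : forall x, U (f x).
Definition subm_lift (x : M) : subm U := mksub (fU x).
Lemma subm_lift_linear : linear subm_lift.
Proof.
move=> a x y; apply: val_inj.
by rewrite [RHS](linearP (subm_val U)) [LHS](linearP f).
Qed.
Definition subm_lin : {linear M -> subm U} := mklin subm_lift_linear.
End Factor.

Lemma linear_kerB x y : f x = 0 -> f y = 0 -> f (x - y) = 0.
Proof. by move=> fx fy; rewrite linearB fx fy subr0. Qed.

Lemma linear_kerZ a x : f x = 0 -> f (a *: x) = 0.
Proof. by move=> fx; rewrite linearZ /= fx scaler0. Qed.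

Definition kersub : submodule M :=
  @Submodule _ _ (@Subgroup M (fun x => f x = 0) (raddf0 f) linear_kerB)
    linear_kerZ.

Definition in_imsub (y : N) := exists x, f x = y.

Lemma imsub0 : in_imsub 0. Proof. by exists 0; rewrite raddf0. Qed.

Lemma imsubB x y : in_imsub x -> in_imsub y -> in_imsub (x - y).
Proof. by move=> [x' <-] [y' <-]; exists (x' - y'); rewrite raddfB. Qed.

Lemma imsubZ a x : in_imsub x -> in_imsub (a *: x).
Proof. by move=> [x' <-]; exists (a *: x'); rewrite linearZ. Qed.

Definition imsub : submodule N :=
  @Submodule _ _ (@Subgroup N in_imsub imsub0 imsubB) imsubZ.

End LinearSub.

Lemma linear_inverse (A : pzRingType) (M N : lmodType A) (f : {linear M -> N}) :
  injective f -> (forall y, exists x, f x = y) ->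
  exists g : {linear N -> M}, cancel f g /\ cancel g f.
Proof.
move=> fI /(inj_surj_bijective fI)[g fK gK].
have gl : linear g by move=> a x y; apply: fI; rewrite linearP !gK.
by exists (mklin gl).
Qed.

(** * Module categories are abelian *)

Section Abelian.
Variable A : pzRingType.
Implicit Types M N X Y : lmodType A.

Lemma zero_linear M N : linear (fun _ : M => 0 : N).
Proof. by move=> a x y; rewrite scaler0 addr0. Qed.

Definition zlin M N : {linear M -> N} := mklin (@zero_linear M N).

Lemma zero_object_trivial (Z : Mod A) :
  (forall z : (Z : lmodType A), z = 0) -> zero_object Z.
Proof.
move=> Z0; split=> X.
  exists (zlin Z X); split=> // f _; apply: linear_funext => z.
  by rewrite (Z0 z) !linear0.
exists (zlin X Z); split=> // f _; apply: linear_funext => z.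
by rewrite [f z]Z0.
Qed.

Lemma trivial_zero_object (Z : Mod A) :
  zero_object Z -> forall z : (Z : lmodType A), z = 0.
Proof.
move=> [_ /(_ Z)[f [_ fU]]] z.
have /linear_eq/(_ z) := etrans (esym (fU (idfun : {linear Z -> Z}) I)) (fU (zlin Z Z) I).
exact.
Qed.

Definition trivial_module : lmodType A :=
  subm (kersub (idfun : {linear A^o -> A^o})).

Lemma trivial_moduleP (z : trivial_module) : z = 0.
Proof. by apply: val_inj; exact: (subgP z). Qed.

Lemma zero_object_trivial_module : @zero_object (Mod A) trivial_module.
Proof. exact/zero_object_trivial/trivial_moduleP. Qed.

Lemma zero_morphismP X Y (f : {linear X -> Y}) :
  @zero_morphism (Mod A) X Y f <-> forall x, f x = 0.
Proof.
split=> [[Z [/trivial_zero_object Z0 [g [h ->]]]] x|f0].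
  by rewrite /= [g x]Z0 linear0.
exists trivial_module; split; first exact: zero_object_trivial_module.
exists (zlin X trivial_module), (zlin trivial_module Y).
by apply: linear_funext => x; rewrite f0.
Qed.

Lemma is_kernel_kersub X Y (f : {linear X -> Y}) :
  @is_kernel (Mod A) X Y (subm (kersub f)) f (subm_val (kersub f)).
Proof.
split; first by apply/zero_morphismP => x; exact: (subgP x).
move=> W g /zero_morphismP g0.
exists (subm_lin (U := kersub f) g0); split; first exact: linear_funext.
move=> u /linear_eq uE.
by apply: linear_funext => w; apply: val_inj; rewrite /= -uE.
Qed.

Lemma is_cokernel_imsub X Y (f : {linear X -> Y}) :
  @is_cokernel (Mod A) X Y (quom (imsub f)) f (quom_proj (imsub f)).
Proof.
split; first by apply/zero_morphismP => x; apply/quom_pi_eq0; exists x.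
move=> W g /zero_morphismP g0.
have gU y : imsub f y -> g y = 0 by case=> x <-; exact: g0.
exists (quom_lin gU); split.
  by apply: linear_funext => y; exact: (quom_liftE gU).
move=> u /linear_eq uE.
apply: linear_funext => z; have [y <-] := quom_pi_surj z.
by rewrite [LHS](quom_liftE gU) -uE.
Qed.

(** The inclusion of the kernel and the zero map have the same composite with [f], so the kernel is
    zero. *)
Lemma monomorphism_inj X Y (f : {linear X -> Y}) :
  @monomorphism (Mod A) X Y f -> injective f.
Proof.
move=> fmono; apply: raddf_inj => x fx.
have : subm_val (kersub f) = zlin _ X.
  apply: fmono; apply: linear_funext => z /=.
  by rewrite linear0; exact: (subgP z).
by move=> /linear_eq /(_ (mksub (U := kersub f) fx)).
Qed.

(** The projection onto the cokernel and the zero map agree after [f], so the cokernel is zero. *)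
Lemma epimorphism_surj X Y (f : {linear X -> Y}) :
  @epimorphism (Mod A) X Y f -> forall y, exists x, f x = y.
Proof.
move=> fepi y; apply/(quom_pi_eq0 (imsub f) y).
have : quom_proj (imsub f) = zlin Y _.
  apply: fepi; apply: linear_funext => x /=.
  by apply/quom_pi_eq0; exists x.
by move=> /linear_eq /(_ y).
Qed.

Lemma is_product_pair X Y :
  @is_product (Mod A) X Y (X * Y)%type
    (fst : {linear (X * Y)%type -> X}) (snd : {linear (X * Y)%type -> Y}).
Proof.
move=> W f g.
have ul : linear (fun w => (f w, g w)) by move=> a x y; rewrite !linearP.
exists (mklin ul); split; first by split; exact: linear_funext.
move=> u [uf ug]; apply: linear_funext => w /=; rewrite -uf -ug /=.
by case: (u w).
Qed.

Lemma inl_linear X Y : linear (fun x : X => (x, 0) : (X * Y)%type).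
Proof.
move=> a x y; rewrite /GRing.scale /GRing.add /= /add_pair /scale_pair /=.
by rewrite scaler0 addr0.
Qed.

Lemma inr_linear X Y : linear (fun y : Y => (0, y) : (X * Y)%type).
Proof.
move=> a x y; rewrite /GRing.scale /GRing.add /= /add_pair /scale_pair /=.
by rewrite scaler0 addr0.
Qed.

Lemma is_coproduct_pair X Y :
  @is_coproduct (Mod A) X Y (X * Y)%type
    (mklin (@inl_linear X Y)) (mklin (@inr_linear X Y)).
Proof.
move=> W f g.
have ul : linear (fun z : X * Y => f z.1 + g z.2).
  by move=> a x y; rewrite !linearP /= scalerDr addrACA.
exists (mklin ul); split.
  split; apply: linear_funext => x /=.
    by rewrite linear0 addr0.
  by rewrite linear0 add0r.
move=> u [uf ug]; apply: linear_funext => -[x y] /=; rewrite -uf -ug /=.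
rewrite -linearD; congr (u _).
by rewrite /GRing.add /= /add_pair /= addr0 add0r.
Qed.

Lemma Mod_abelian : abelian (Mod A).
Proof.
split.
- exists trivial_module; exact: zero_object_trivial_module.
- by move=> X Y; do 3 eexists; exact: is_product_pair.
- by move=> X Y; do 3 eexists; exact: is_coproduct_pair.
- by move=> X Y f; do 2 eexists; exact: is_kernel_kersub.
- by move=> X Y f; do 2 eexists; exact: is_cokernel_imsub.
- move=> X Y f /monomorphism_inj fI.
  exists (quom (imsub f) : lmodType A), (quom_proj (imsub f)); split.
    by apply/zero_morphismP => x; apply/quom_pi_eq0; exists x.
  move=> W g /zero_morphismP g0.
  have /choice[u uE] w : exists x, f x = g w.
    exact: (quom_pi_eq0 (imsub f) (g w)).1 (g0 w).
  have ul : linear u by move=> a x y; apply: fI; rewrite linearP !uE linearP.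
  exists (mklin ul); split; first exact: linear_funext.
  move=> v /linear_eq vE.
  by apply: linear_funext => w; apply: fI; rewrite uE -vE.
- move=> X Y f /epimorphism_surj fS.
  exists (subm (kersub f) : lmodType A), (subm_val (kersub f)); split.
    by apply/zero_morphismP => x; exact: (subgP x).
  move=> W g /zero_morphismP g0.
  have gE x x' : f x = f x' -> g x = g x'.
    move=> fxx'; apply/eqP; rewrite -subr_eq0 -linearB; apply/eqP.
    have kx : kersub f (x - x') by rewrite /= linearB /= fxx' subrr.
    exact: (g0 (mksub kx)).
  have [h hK] := choice fS.
  (* The section [h] is an arbitrary choice; [g] is constant on the fibres of [f], which makes the
     composite linear. *)
  have ul : linear (g \o h).
    by move=> a x y /=; rewrite -linearP; apply: gE; rewrite linearP !hK.
  exists (mklin ul); split.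
    by apply: linear_funext => x; apply: gE; rewrite hK.
  move=> v /linear_eq vE.
  by apply: linear_funext => y; rewrite -[in RHS](hK y) /= -vE.
Qed.

End Abelian.

(** * Adjunctions from universal arrows *)

Definition invertible (C : category) (X Y : C) (f : hom X Y) :=
  exists g : hom Y X, mcomp g f = idm X /\ mcomp f g = idm Y.

Section Unit.
Variables (C D : category) (F : functor C D) (G : functor D C).
Variable eta : forall X : C, hom X (G (F X)).
Hypothesis eta_nat : forall (X X' : C) (a : hom X X'),
  mcomp (eta X') a = mcomp (fmap G (fmap F a)) (eta X).
Hypothesis eta_univ : forall (X : C) (Y : D) (f : hom X (G Y)),
  exists! g : hom (F X) Y, mcomp (fmap G g) (eta X) = f.

Lemma unit_inj X Y (g g' : hom (F X) Y) :
  mcomp (fmap G g) (eta X) = mcomp (fmap G g') (eta X) -> g = g'.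
Proof.
by move=> e; have [h [_ hU]] := eta_univ (mcomp (fmap G g') (eta X));
  rewrite -(hU g e) -(hU g' erefl).
Qed.

Lemma left_adjoint_unit : left_adjoint F G.
Proof.
exists (fun X Y g => mcomp (fmap G g) (eta X)); split.
  move=> X Y; apply: inj_surj_bijective => [g g'|f]; first exact: unit_inj.
  by have [g [ge _]] := eta_univ f; exists g.
by move=> X X' Y Y' a b f; rewrite !fmapM -!mcompA eta_nat.
Qed.

(** Under the adjunction bijection [fmap F] becomes composition with [eta X'], which is bijective
    once the unit is invertible. *)
Lemma fully_faithful_unit :
  (forall X, invertible (eta X)) -> fully_faithful F.
Proof.
move=> etaV X X'; have [v [v1 v2]] := etaV X'.
apply: inj_surj_bijective => [f f' e|h].
  have : mcomp (eta X') f = mcomp (eta X') f' by rewrite !eta_nat e.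
  by move/(congr1 (mcomp v)); rewrite !mcompA v1 !mcomp1m.
exists (mcomp v (mcomp (fmap G h) (eta X))); apply: unit_inj.
by rewrite -eta_nat mcompA v2 mcomp1m.
Qed.

End Unit.

Section Counit.
Variables (C D : category) (F : functor C D) (G : functor D C).
Variable eps : forall Y : D, hom (F (G Y)) Y.
Hypothesis eps_nat : forall (Y Y' : D) (b : hom Y Y'),
  mcomp b (eps Y) = mcomp (eps Y') (fmap F (fmap G b)).
Hypothesis eps_univ : forall (X : C) (Y : D) (f : hom (F X) Y),
  exists! g : hom X (G Y), mcomp (eps Y) (fmap F g) = f.

Lemma counit_inj X Y (g g' : hom X (G Y)) :
  mcomp (eps Y) (fmap F g) = mcomp (eps Y) (fmap F g') -> g = g'.
Proof.
by move=> e; have [h [_ hU]] := eps_univ (mcomp (eps Y) (fmap F g'));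
  rewrite -(hU g e) -(hU g' erefl).
Qed.

Lemma left_adjoint_counit : left_adjoint F G.
Proof.
(* The counit gives the transposition from right to left; the required direction is its inverse,
   obtained by choice. *)
pose phi X Y (f : hom (F X) Y) := projT1 (cid (eps_univ f)).
have phiE X Y (f : hom (F X) Y) : mcomp (eps Y) (fmap F (phi X Y f)) = f.
  by rewrite /phi; case: cid => g [].
exists phi; split.
  move=> X Y; apply: inj_surj_bijective => [f f' e|g].
    by rewrite -(phiE _ _ f) e phiE.
  by exists (mcomp (eps Y) (fmap F g)); apply: counit_inj; rewrite phiE.
move=> X X' Y Y' a b f; apply: counit_inj.
by rewrite phiE !fmapM !mcompA -eps_nat -(mcompA b (eps Y)) phiE.
Qed.

Lemma fully_faithful_counit :
  (forall Y, invertible (eps Y)) -> fully_faithful G.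
Proof.
move=> epsV Y Y'; have [v [v1 v2]] := epsV Y.
apply: inj_surj_bijective => [f f' e|h].
  have : mcomp f (eps Y) = mcomp f' (eps Y) by rewrite !eps_nat e.
  by move/(congr1 (fun k => mcomp k v)); rewrite -!mcompA v2 !mcompm1.
exists (mcomp (mcomp (eps Y') (fmap F h)) v); apply: counit_inj.
by rewrite -eps_nat -mcompA v1 mcompm1.
Qed.

End Counit.

Lemma invertible_linear (A : pzRingType) (M N : lmodType A)
    (f : {linear M -> N}) :
  injective f -> (forall y, exists x, f x = y) -> @invertible (Mod A) M N f.
Proof.
move=> fI /(linear_inverse fI)[g [fK gK]]; exists g.
by split; apply: linear_funext.
Qed.

(** * The core of a graph *)

Section Core.
Variable E : digraph.
Implicit Types (v : vertex E) (e : edge E) (X : {set vertex E}).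
Local Notation T := (core_vertices E).

(* The vertices from which every path is finite, i.e. those removed when only
   sinks are eliminated. *)
Inductive dead : vertex E -> Prop :=
| Dead v : (forall e, src e = v -> dead (rng e)) -> dead v.

Lemma dead_rng e : dead (src e) -> dead (rng e).
Proof.
have H v : dead v -> forall f, src f = v -> dead (rng f) by case.
by move/H; apply.
Qed.

Lemma dead_sink v : is_sink v -> dead v.
Proof.
move=> /forallP vsink; constructor=> e ev.
by have := vsink e; rewrite ev eqxx.
Qed.

Lemma not_dead v : ~ dead v -> exists e, src e = v /\ ~ dead (rng e).
Proof.
move=> vN; apply: contrapT => H; apply: vN; constructor=> e ev.
by apply: contrapT => eN; apply: H; exists e.
Qed.

Lemma core_outedge v : v \in T -> exists e, src e = v /\ rng e \in T.
Proof.
move=> vT; have /forallPn[e] := core_no_sink (exist _ v vT : vertex (core E)).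
rewrite negbK => /eqP/(congr1 val) /= ev; exists (val e); split=> //.
by case/andP: (valP e).
Qed.

Lemma core_inedge v : v \in T -> exists e, rng e = v /\ src e \in T.
Proof.
move=> vT; have /forallPn[e] := core_no_source (exist _ v vT : vertex (core E)).
rewrite negbK => /eqP/(congr1 val) /= ev; exists (val e); split=> //.
by case/andP: (valP e).
Qed.

(** The inner edges of [X] survive each round of pruning, so no vertex of [X] ever becomes a sink or
    a source. This is the maximality of the core. *)
Lemma sub_core X :
  (forall v, v \in X -> exists e, src e = v /\ rng e \in X) ->
  (forall v, v \in X -> exists e, rng e = v /\ src e \in X) ->
  X \subset T.
Proof.
move=> Xout Xin; rewrite /core_vertices; elim: #|_| => [|n IH] /=.
  exact: subsetT.
apply/subsetP => v vX; have XY := subsetP IH.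
apply/imsetP; exists (exist _ v (XY v vX)) => //; rewrite inE.
apply/andP; split; apply/forallPn.
  have [e [ev re]] := Xout v vX.
  have eP : (src e \in iter n (@prune E) setT)
      && (rng e \in iter n (@prune E) setT) by rewrite !XY ?ev.
  by exists (exist _ e eP); rewrite negbK; apply/eqP/val_inj.
have [e [ev se]] := Xin v vX.
have eP : (src e \in iter n (@prune E) setT)
    && (rng e \in iter n (@prune E) setT) by rewrite !XY ?ev.
by exists (exist _ e eP); rewrite negbK; apply/eqP/val_inj.
Qed.

Lemma dead_notin_core v : dead v -> v \notin T.
Proof.
elim=> {}v _ IH; apply/negP => /core_outedge[e [ev re]].
by have := IH e ev; rewrite re.
Qed.

(* A minimal nonempty set in which every vertex has an out-edge equals the set
   of ranges of its inner edges, hence has in-edges too and lies in the core. *)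
Lemma core_ind (P : vertex E -> Prop) :
  (forall v, v \in T -> P v) ->
  (forall v, v \notin T -> (forall e, src e = v -> P (rng e)) -> P v) ->
  forall v, P v.
Proof.
move=> PT Pstep v; apply: contrapT => vP.
pose out X := [forall v in X, [exists e, (src e == v) && (rng e \in X)]].
have out_step w : ~ P w -> exists e, src e = w /\ ~ P (rng e).
  move=> wP; apply: contrapT => H; apply: wP.
  have [/PT //|wT] := boolP (w \in T).
  apply: Pstep => // e ew; apply: contrapT => eP; apply: H; by exists e.
pose X := [set w | `[< ~ P w >]].
have XP w : w \in X <-> ~ P w by rewrite inE; split=> /asboolP.
have Xout : (X != set0) && out X.
  apply/andP; split; first by apply/set0Pn; exists v; apply/XP.
  apply/forall_inP => w /XP/out_step[e [<- /XP eX]].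
  by apply/existsP; exists e; rewrite eqxx.
have [Y /minsetP[/andP[Y0 /forall_inP Yout] Ymin] YX] :=
  minset_exists (P := fun Z => (Z != set0) && out Z) Xout.
pose Y' := [set rng e | e : edge E & (src e \in Y) && (rng e \in Y)].
have Y'Y : Y' \subset Y.
  by apply/subsetP => w /imsetP[e]; rewrite inE => /andP[_ re] ->.
have eY' w : w \in Y -> exists e, src e = w /\ rng e \in Y'.
  move=> wY; have /existsP[e /andP[/eqP ew re]] := Yout w wY.
  by exists e; split=> //; apply/imsetP; exists e; rewrite // inE ew wY.
have YY' : Y' = Y.
  apply: Ymin => //; apply/andP; split.
    have /set0Pn[w /eY'[e [_ re]]] := Y0.
    by apply/set0Pn; exists (rng e).
  apply/forall_inP => w /(subsetP Y'Y)/eY'[e [ew re]].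
  by apply/existsP; exists e; rewrite ew eqxx.
have YT : Y \subset T.
  apply: sub_core => w; first by move/eY'; rewrite YY'.
  rewrite -{1}YY' => /imsetP[e]; rewrite inE => /andP[se _] ->.
  by exists e.
have /set0Pn[w wY] := Y0.
have /XP := subsetP YX w wY; apply; apply: PT.
exact: (subsetP YT).
Qed.

(** The non-dead vertices reachable from the core form a set in which every vertex has an in-edge
    and an out-edge, hence a subset of the core. If [rng e] were not dead it would belong to this
    set. *)
Lemma core_exit e : src e \in T -> rng e \notin T -> dead (rng e).
Proof.
move=> eT; apply: contraNP => eN.
pose step v w := [exists e, (src e == v) && (rng e == w)].
pose Y := [set w | `[< ~ dead w >] &&
  [exists v in T, connect step v w]].
have stepY f : src f \in Y -> ~ dead (rng f) -> rng f \in Y.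
  rewrite !inE => /andP[_ /exists_inP[v vT vf]] fN.
  apply/andP; split; first exact/asboolP.
  apply/exists_inP; exists v => //; apply: connect_trans vf (connect1 _).
  by apply/existsP; exists f; rewrite !eqxx.
have TY v : v \in T -> v \in Y.
  move=> vT; rewrite inE; apply/andP; split.
    by apply/asboolP => /dead_notin_core; rewrite vT.
  by apply/exists_inP; exists v.
suff /subsetP : Y \subset T by apply; exact: stepY (TY _ eT) eN.
apply: sub_core => w wY.
  have /asboolP/not_dead[f [fw fN]] : `[< ~ dead w >].
    by move: wY; rewrite inE => /andP[].
  by exists f; split=> //; apply: stepY; rewrite ?fw.
have := wY; rewrite inE => /andP[/asboolP wN /exists_inP[v vT]].
(* If the path is trivial, its vertex is in the core, which supplies an in-edge. Otherwise the last
   edge of the path serves: its source is not dead because deadness passes from source to range. *)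
move=> /connectP[p]; case/lastP: p => [_ wv|p u].
  have /core_inedge[f [fv fT]] := vT.
  by exists f; rewrite fv wv; split=> //; exact: TY.
rewrite rcons_path last_rcons => /andP[vp /existsP[f /andP[/eqP fl /eqP fu]]] uw.
exists f; rewrite fu uw; split=> //; rewrite inE; apply/andP; split.
  by apply/asboolP => /dead_rng; rewrite fu -uw.
by apply/exists_inP; exists v => //; apply/connectP; exists p.
Qed.

End Core.

(** * Modules over Leavitt path algebras *)

Section Generators.
Variables (K : fieldType) (E : digraph).

Definition lv (v : vertex E) : lpa K E := lpa_pi (LVertex v).
Definition le (e : edge E) : lpa K E := lpa_pi (LEdge e).
Definition lg (e : edge E) : lpa K E := lpa_pi (LGhost e).
(** Modules are taken over the ring alone; these central elements carry the action of [K] on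
    them. *)
Definition lk (k : K) : lpa K E := k *: (1 : lpa K E).

Lemma pi_lpaD x y : lpa_pi (LAdd x y) = lpa_pi x + lpa_pi y :> lpa K E.
Proof. by rewrite -lpa_piD. Qed.

Lemma pi_lpaN x : lpa_pi (LOpp x) = - lpa_pi x :> lpa K E.
Proof. by rewrite -lpa_piN. Qed.

Lemma pi_lpaM x y : lpa_pi (LMul x y) = lpa_pi x * lpa_pi y :> lpa K E.
Proof. by rewrite -lpa_piM. Qed.

Lemma pi_lpaZ k x : lpa_pi (LScale k x) = lk k * lpa_pi x :> lpa K E.
Proof. by rewrite -lpa_scalerAl mul1r -lpa_piZ. Qed.

Lemma lvM v w : lv v * lv w = if v == w then lv v else 0.
Proof. exact: lpa_vertex_mul. Qed.

Lemma lv_le e : lv (src e) * le e = le e.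
Proof. by rewrite -pi_lpaM; apply/lpa_piP; exact: lpa_src_edge. Qed.

Lemma le_lv e : le e * lv (rng e) = le e.
Proof. by rewrite -pi_lpaM; apply/lpa_piP; exact: lpa_edge_rng. Qed.

Lemma lv_lg e : lv (rng e) * lg e = lg e.
Proof. by rewrite -pi_lpaM; apply/lpa_piP; exact: lpa_rng_ghost. Qed.

Lemma lg_lv e : lg e * lv (src e) = lg e.
Proof. by rewrite -pi_lpaM; apply/lpa_piP; exact: lpa_ghost_src. Qed.

Lemma lv_le_eq (v : vertex E) (e : edge E) : lv v * le e = if src e == v then le e else 0.
Proof.
rewrite -[le e]lv_le mulrA lvM eq_sym.
by case: eqP => [->|]; rewrite ?lv_le ?mul0r.
Qed.

Lemma lg_lv_eq (v : vertex E) (e : edge E) : lg e * lv v = if src e == v then lg e else 0.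
Proof.
rewrite -[lg e]lg_lv -mulrA lvM.
by case: eqP; rewrite ?lg_lv ?mulr0.
Qed.

Lemma lg_le e f : lg e * le f = if e == f then lv (rng e) else 0.
Proof.
rewrite -pi_lpaM (_ : 0 = lpa_pi LZero) // /lv -fun_if.
by apply/lpa_piP; exact: lpa_ghostM.
Qed.

Lemma lv_sum v : ~~ is_sink v -> lv v = \sum_(e | src e == v) le e * lg e.
Proof.
move=> vN; have -> : lv v = lpa_pi (\big[@LAdd K E/LZero]_(e : edge E | src e == v)
   LMul (LEdge e) (LGhost e)) by apply/lpa_piP; exact: lpa_cuntz_krieger.
rewrite (big_morph (@lpa_pi K E) pi_lpaD (erefl : lpa_pi LZero = 0)).
by apply: eq_bigr => e _; rewrite pi_lpaM.
Qed.

Lemma sum_lv : \sum_v lv v = 1.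
Proof. by rewrite -[RHS]/(lpa_one K E) lpa_oneE. Qed.

Lemma lkM a b : lk a * lk b = lk (a * b).
Proof. by rewrite -lpa_scalerAl mul1r scalerA. Qed.

Lemma lkD a b : lk (a + b) = lk a + lk b.
Proof. exact: scalerDl. Qed.

Lemma lk0 : lk 0 = 0. Proof. exact: scale0r. Qed.

Lemma lk1 : lk 1 = 1. Proof. exact: scale1r. Qed.

Lemma lk_comm k x : lk k * x = x * lk k.
Proof. by rewrite -lpa_scalerAl -lpa_scalerAr mul1r mulr1. Qed.

Lemma lpa_gen_ind (P : lpa K E -> Prop) :
  (forall v, P (lv v)) -> (forall e, P (le e)) -> (forall e, P (lg e)) ->
  (forall k, P (lk k)) -> P 0 -> (forall x y, P x -> P y -> P (x + y)) ->
  (forall x, P x -> P (- x)) -> (forall x y, P x -> P y -> P (x * y)) ->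
  forall x, P x.
Proof.
move=> Pv Pe Pg Pk P0 PD PN PM; elim/lpa_ind.
elim=> [v|e|e||x IHx y IHy|x IHx|x IHx y IHy|k x IHx].
- exact: Pv.
- exact: Pe.
- exact: Pg.
- exact: P0.
- by rewrite pi_lpaD; exact: PD.
- by rewrite pi_lpaN; exact: PN.
- by rewrite pi_lpaM; exact: PM.
- by rewrite pi_lpaZ; exact: PM.
Qed.

(** The ring elements whose action commutes with [f] form a subring, so the generators suffice. *)
Lemma lpa_linear (M N : lmodType (lpa K E)) (f : {additive M -> N}) :
  (forall v x, f (lv v *: x) = lv v *: f x) ->
  (forall e x, f (le e *: x) = le e *: f x) ->
  (forall e x, f (lg e *: x) = lg e *: f x) ->
  (forall k x, f (lk k *: x) = lk k *: f x) -> linear f.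
Proof.
move=> fv fe fg fk a x y; rewrite raddfD; congr (_ + _).
elim/lpa_gen_ind: a x => //.
- by move=> x; rewrite !scale0r raddf0.
- by move=> a b IHa IHb x; rewrite !scalerDl raddfD IHa IHb.
- by move=> a IHa x; rewrite !scaleNr raddfN IHa.
- by move=> a b IHa IHb x; rewrite -!scalerA IHa IHb.
Qed.

End Generators.

Lemma sum_lv_scale (K : fieldType) (E : digraph) (M : lmodType (lpa K E))
  (m : M) : \sum_v lv K v *: m = m.
Proof. by rewrite -scaler_suml sum_lv scale1r. Qed.

(** * Modules given by operators satisfying the defining relations *)

Record lpa_rep (K : fieldType) (E : digraph) (X : zmodType) := LpaRep {
  rv : vertex E -> X -> X;
  re : edge E -> X -> X;
  rg : edge E -> X -> X;
  rk : K -> X -> X;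
  rvB : forall v, zmod_morphism (rv v);
  reB : forall e, zmod_morphism (re e);
  rgB : forall e, zmod_morphism (rg e);
  rkB : forall k, zmod_morphism (rk k);
  rv_rv : forall v w x, rv v (rv w x) = if v == w then rv v x else 0;
  rv_re : forall e x, rv (src e) (re e x) = re e x;
  re_rv : forall e x, re e (rv (rng e) x) = re e x;
  rv_rg : forall e x, rv (rng e) (rg e x) = rg e x;
  rg_rv : forall e x, rg e (rv (src e) x) = rg e x;
  rg_re : forall e f x, rg e (re f x) = if e == f then rv (rng e) x else 0;
  rv_sum : forall v x, ~~ is_sink v ->
    rv v x = \sum_(e | src e == v) re e (rg e x);
  sum_rv : forall x, \sum_v rv v x = x;
  rkA : forall a b x, rk a (rk b x) = rk (a * b) x;
  rk1 : forall x, rk 1 x = x;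
  rkD : forall a b x, rk (a + b) x = rk a x + rk b x;
  rk_rv : forall k v x, rk k (rv v x) = rv v (rk k x);
  rk_re : forall k e x, rk k (re e x) = re e (rk k x);
  rk_rg : forall k e x, rk k (rg e x) = rg e (rk k x) }.

Section RepModule.
Variables (K : fieldType) (E : digraph) (X : zmodType) (r : lpa_rep K E X).

Fixpoint reval (t : lpa_term K E) (x : X) : X :=
  match t with
  | LVertex v => rv r v x
  | LEdge e => re r e x
  | LGhost e => rg r e x
  | LZero => 0
  | LAdd t u => reval t x + reval u x
  | LOpp t => - reval t x
  | LMul t u => reval t (reval u x)
  | LScale k t => rk r k (reval t x)
  end.

Lemma revalB t : zmod_morphism (reval t).
Proof.
elim: t => [v|e|e||t IHt u IHu|t IHt|t IHt u IHu|k t IHt] x y /=.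
- exact: rvB.
- exact: reB.
- exact: rgB.
- by rewrite subr0.
- by rewrite IHt IHu opprD addrACA.
- by rewrite IHt opprB opprK addrC.
- by rewrite IHu IHt.
- by rewrite IHt rkB.
Qed.

HB.instance Definition _ t := GRing.isZmodMorphism.Build X X (reval t)
  (revalB t).
HB.instance Definition _ k := GRing.isZmodMorphism.Build X X (rk r k)
  (rkB r k).

(** This is what the rule a(xy) = x(ay) requires; the commutativity of [K] enters in the case of a
    scalar multiple. *)
Lemma reval_rk t k x : reval t (rk r k x) = rk r k (reval t x).
Proof.
elim: t x => [v|e|e||t IHt u IHu|t IHt|t IHt u IHu|l t IHt] x /=.
- by rewrite rk_rv.
- by rewrite rk_re.
- by rewrite rk_rg.
- by rewrite raddf0.
- by rewrite IHt IHu raddfD.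
- by rewrite IHt raddfN.
- by rewrite IHu IHt.
- by rewrite IHt !rkA mulrC.
Qed.

(** Each rule generating the congruence is matched by an axiom of the representation, so evaluation
    descends to the quotient [lpa]. *)
Lemma reval_eq t u : lpa_eq t u -> reval t =1 reval u.
Proof.
elim=> {t u} //=.
- by move=> t u _ IH x; rewrite IH.
- by move=> t u s _ IH1 _ IH2 x; rewrite IH1.
- by move=> t t' u u' _ IHt _ IHu x; rewrite IHt IHu.
- by move=> t t' _ IH x; rewrite IH.
- by move=> t t' u u' _ IHt _ IHu x; rewrite IHt IHu.
- by move=> k t t' _ IH x; rewrite IH.
- by move=> t u s x; rewrite addrA.
- by move=> t u x; rewrite addrC.
- by move=> t x; rewrite add0r.
- by move=> t x; rewrite addNr.
- by move=> t u s x; rewrite raddfD.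
- by move=> a b t x; rewrite rkA.
- by move=> t x; rewrite rk1.
- by move=> a t u x; rewrite raddfD.
- by move=> a b t x; rewrite rkD.
- by move=> a t u x; rewrite reval_rk.
- by move=> v w x; rewrite rv_rv; case: ifP.
- by move=> e x; rewrite rv_re.
- by move=> e x; rewrite re_rv.
- by move=> e x; rewrite rv_rg.
- by move=> e x; rewrite rg_rv.
- by move=> e f x; rewrite rg_re; case: ifP.
move=> v vN x; rewrite (rv_sum r x vN).
by rewrite (big_morph (fun t => reval t x) (id1 := 0) (op1 := +%R)).
Qed.

(** The representation is a tag on the carrier, from which the module structure is inferred. *)
Definition rep_module_of of lpa_rep K E X : Type := X.
Local Notation rep_module := (rep_module_of r).
HB.instance Definition _ := GRing.Zmodule.copy rep_module X.

Definition rep_scale (a : lpa K E) (x : rep_module) : rep_module :=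
  reval (lpa_repr a) x.

Lemma rep_scaleE t x : rep_scale (lpa_pi t) x = reval t x.
Proof. exact: reval_eq (lpa_piK t) x. Qed.

Lemma rep_scaleA a b x : rep_scale a (rep_scale b x) = rep_scale (a * b) x.
Proof.
elim/lpa_ind: a => t; elim/lpa_ind: b => u.
by rewrite -pi_lpaM !rep_scaleE.
Qed.

Lemma rep_scale1 : left_id 1 rep_scale.
Proof.
move=> x; rewrite -[1]/(lpa_pi _) rep_scaleE.
rewrite (big_morph (fun t => reval t x) (id1 := 0) (op1 := +%R)) //=.
exact: (sum_rv r x).
Qed.

Lemma rep_scaleDr : right_distributive rep_scale +%R.
Proof. by move=> a x y; rewrite /rep_scale raddfD. Qed.

Lemma rep_scaleDl x : {morph rep_scale^~ x : a b / a + b}.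
Proof.
elim/lpa_ind=> t; elim/lpa_ind=> u.
by rewrite -pi_lpaD !rep_scaleE.
Qed.

HB.instance Definition _ := GRing.Zmodule_isLmodule.Build (lpa K E) rep_module
  rep_scaleA rep_scale1 rep_scaleDr rep_scaleDl.

Implicit Types x : rep_module.

Lemma rep_lv v x : lv K v *: x = rv r v x.
Proof. exact: rep_scaleE. Qed.

Lemma rep_le e x : le K e *: x = re r e x.
Proof. exact: rep_scaleE. Qed.

Lemma rep_lg e x : lg K e *: x = rg r e x.
Proof. exact: rep_scaleE. Qed.

Lemma rep_lk k x : lk E k *: x = rk r k x.
Proof.
pose one := \big[@LAdd K E/LZero]_(v : vertex E) LVertex v.
have -> : lk E k = lpa_pi (LScale k one) by rewrite -lpa_piZ.
rewrite [LHS]rep_scaleE /=; congr (rk r k _).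
by rewrite -rep_scaleE; exact: rep_scale1.
Qed.

End RepModule.

(* Otherwise unification attempts unfold the generators down to the quotient. *)
#[global] Opaque lv le lg lk.

(** * Modules of functions on paths *)

(* A ring [R] acting like the Leavitt path algebra of the subgraph induced on
   [T], except that the Cuntz-Krieger relation is only required at the vertices
   that are not sinks of the whole graph [E]. The edges leaving [T] end in [cD],
   from which no path leads back to [T]. *)
Record corner_data (K : fieldType) (E : digraph) (T : pred (vertex E))
    (R : pzRingType) := CornerData {
  cv : vertex E -> R;
  ce : edge E -> R;
  cg : edge E -> R;
  ck : K -> R;
  cv_out : forall v, ~~ T v -> cv v = 0;
  ce_out : forall e, ~~ T (src e) -> ce e = 0;
  cg_out : forall e, ~~ T (src e) -> cg e = 0;
  cv_cv : forall v w, cv v * cv w = if v == w then cv v else 0;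
  cv_ce : forall e, cv (src e) * ce e = ce e;
  ce_cv : forall e, ce e * cv (rng e) = ce e;
  cv_cg : forall e, cv (rng e) * cg e = cg e;
  cg_cv : forall e, cg e * cv (src e) = cg e;
  cg_ce : forall e f, T (src e) ->
    cg e * ce f = if e == f then cv (rng e) else 0;
  cv_sum : forall v, T v -> ~~ is_sink v ->
    cv v = \sum_(e | src e == v) ce e * cg e;
  sum_cv : \sum_v cv v = 1;
  ckM : forall a b, ck a * ck b = ck (a * b);
  ck1 : ck 1 = 1;
  ckD : forall a b, ck (a + b) = ck a + ck b;
  ck_cv : forall k v, ck k * cv v = cv v * ck k;
  ck_ce : forall k e, ck k * ce e = ce e * ck k;
  ck_cg : forall k e, ck k * cg e = cg e * ck k;
  cD : vertex E -> Prop;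
  cD_out : forall v, cD v -> ~~ T v;
  cD_rng : forall e : edge E, cD (src e) -> cD (rng e);
  cD_exit : forall e : edge E, T (src e) -> ~~ T (rng e) -> cD (rng e) }.

Section PathModule.
Variables (K : fieldType) (E : digraph) (T : pred (vertex E)) (R : pzRingType).
Variable c : corner_data K T R.
Variable fin : bool.

Section Space.
Variable N : lmodType R.
Implicit Types (es : seq (edge E)) (n : N).

(* A path is the sequence of its edges, leading from its source, through
   vertices outside [T], to a vertex of [T]; all the trivial paths at vertices
   of [T] are encoded together by the empty sequence. [hd v es] is the
   projection to the component of paths with source [v]. As the graph is
   finite, finite support means that the lengths of paths are bounded. *)
Definition hd v es n : N :=
  if es is e :: _ then if src e == v then n else 0 else cv c v *: n.

(** Ranging over all splittings [l ++ e :: es] replaces a type of paths: a nonzero value forces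
    every edge to end where the next one starts, the value itself to lie in the component of the
    last range, and every edge to start outside [T]. *)
Definition path_fun (f : seq (edge E) -> N) :=
  (forall l e es, hd (rng e) es (f (l ++ e :: es)) = f (l ++ e :: es) /\
     (T (src e) -> f (l ++ e :: es) = 0)) /\
  (fin -> exists m, forall es, (m <= size es)%N -> f es = 0).

Lemma hdB v es : zmod_morphism (hd v es).
Proof.
case: es => [|e es] x y /=; first exact: scalerBr.
by case: ifP; rewrite ?subr0.
Qed.

HB.instance Definition _ v es := GRing.isZmodMorphism.Build N N (hd v es)
  (hdB v es).

Lemma hd_hd v w es n : hd v es (hd w es n) = if v == w then hd v es n else 0.
Proof.
case: es => [|e es] /=.
  by rewrite scalerA cv_cv; case: ifP; rewrite ?scale0r.
case: eqVneq => [->|vw]; first by case: ifP.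
by case: eqP => // ->; rewrite eq_sym (negPf vw) if_same.
Qed.

Lemma hd_ck v es k n : hd v es (ck c k *: n) = ck c k *: hd v es n.
Proof.
case: es => [|e es] /=; first by rewrite !scalerA ck_cv.
by case: ifP; rewrite ?scaler0.
Qed.

Lemma sum_hd es n : \sum_v hd v es n = n.
Proof.
case: es => [|e es] /=; first by rewrite -scaler_suml sum_cv scale1r.
by rewrite -big_mkcond (big_pred1 (src e)) // => v; exact: eq_sym.
Qed.

Lemma path_fun0 : path_fun 0.
Proof.
split=> [l e es|_]; last by exists 0.
by split=> //; exact: raddf0.
Qed.

Lemma path_funB f g : path_fun f -> path_fun g -> path_fun (f - g).
Proof.
move=> [f1 f2] [g1 g2]; split=> [l e es|fi].
  have [fE fT] := f1 l e es; have [gE gT] := g1 l e es.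
  split=> [|eT]; first by rewrite raddfB /= fE gE.
  by rewrite /= -[LHS]/(f _ - g _) fT // gT // subr0.
have [m fm] := f2 fi; have [m' gm] := g2 fi; exists (maxn m m') => es.
by rewrite geq_max => /andP[? ?]; rewrite -[LHS]/(f _ - g _) fm // gm // subr0.
Qed.

Definition path_fun_subgroup := Subgroup path_fun0 path_funB.
Definition pspace := subg path_fun_subgroup.

(** Reading [f] as the formal sum of p f(p) over the paths p, these are the left multiplications: an
    edge is prepended, a ghost edge cancels the first edge. An edge starting in [T] prolongs no path
    and acts through the ring on the value at the empty path. *)
Definition fun_v v (f : seq (edge E) -> N) es := hd v es (f es).
Definition fun_e e (f : seq (edge E) -> N) es : N :=
  if es is e' :: es' then
    if (e' == e) && ~~ T (src e) then hd (rng e) es' (f es') else 0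
  else ce c e *: f [::].
Definition fun_g e (f : seq (edge E) -> N) es : N :=
  f (e :: es) + (if es is [::] then cg c e *: f [::] else 0).
Definition fun_k k (f : seq (edge E) -> N) es : N := ck c k *: f es.

Lemma path_fun_v v f : path_fun f -> path_fun (fun_v v f).
Proof.
move=> [f1 f2]; split=> [l e es|fi]; last first.
  have [m fm] := f2 fi; exists m => es /fm; rewrite /fun_v => ->.
  exact: raddf0.
have [fE fT] := f1 l e es; rewrite /fun_v; split; last first.
  by move=> /fT ->; exact: raddf0.
case: l fE {fT} => [|e' l] /= fE; case: ifP => // _; exact: raddf0.
Qed.

Lemma path_fun_e e f : path_fun f -> path_fun (fun_e e f).
Proof.
move=> [f1 f2]; split=> [l e' es|fi]; last first.
  have [m fm] := f2 fi; exists m.+1 => -[|e' es] //=.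
  by rewrite ltnS => /fm ->; case: ifP => // _; exact: raddf0.
case: l => [|e1 l] /=.
  case: ifP => [/andP[/eqP -> eT]|_]; last by rewrite raddf0.
  by rewrite hd_hd eqxx (negPf eT).
have [fE fT] := f1 l e' es.
case: ifP => _; last by rewrite raddf0.
split=> [|/fT ->]; last exact: raddf0.
by case: l fE {fT} => [|e2 l] /= fE; case: ifP => // _; rewrite ?raddf0.
Qed.

Lemma path_fun_g e f : path_fun f -> path_fun (fun_g e f).
Proof.
move=> [f1 f2]; split=> [l e' es|fi]; last first.
  have [m fm] := f2 fi; exists m.+1 => -[|e' es] //= ms.
  by rewrite /fun_g fm ?addr0 //= ltnW // ltnW.
have [fE fT] := f1 (e :: l) e' es; rewrite /fun_g.
have -> z : (if l ++ e' :: es is [::] then z else 0) = 0 :> N by case: (l).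
by rewrite addr0.
Qed.

Lemma path_fun_k k f : path_fun f -> path_fun (fun_k k f).
Proof.
move=> [f1 f2]; split=> [l e es|fi]; last first.
  have [m fm] := f2 fi; exists m => es /fm; rewrite /fun_k => ->.
  exact: scaler0.
have [fE fT] := f1 l e es; rewrite /fun_k hd_ck fE; split=> // /fT ->.
exact: scaler0.
Qed.

Definition ps_v v (f : pspace) : pspace := 
  @mksub _ path_fun_subgroup _ (path_fun_v v (subgP f)).
Definition ps_e e (f : pspace) : pspace := 
  @mksub _ path_fun_subgroup _ (path_fun_e e (subgP f)).
Definition ps_g e (f : pspace) : pspace := 
  @mksub _ path_fun_subgroup _ (path_fun_g e (subgP f)).
Definition ps_k k (f : pspace) : pspace := 
  @mksub _ path_fun_subgroup _ (path_fun_k k (subgP f)).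

Definition pfun (f : pspace) : seq (edge E) -> N := val f.

Implicit Types f g : pspace.

Lemma pspaceP f g : (forall es, pfun f es = pfun g es) -> f = g.
Proof. by move=> fg; apply: val_inj; apply/funext. Qed.

Lemma pfunB f g es : pfun (f - g) es = pfun f es - pfun g es.
Proof. by rewrite /pfun raddfB. Qed.

Lemma pfunD f g es : pfun (f + g) es = pfun f es + pfun g es.
Proof. by rewrite /pfun raddfD. Qed.

Lemma pfun0 es : pfun 0 es = 0.
Proof. by rewrite /pfun raddf0. Qed.

Lemma pfun_sum I r (P : pred I) (F : I -> pspace) es :
  pfun (\sum_(i <- r | P i) F i) es = \sum_(i <- r | P i) pfun (F i) es.
Proof.
apply: (big_morph (fun f : pspace => pfun f es)) => [f g|].
  exact: pfunD.
exact: pfun0.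
Qed.

Lemma pfun_v v f es : pfun (ps_v v f) es = hd v es (pfun f es).
Proof. by []. Qed.

Lemma pfun_e_nil e f : pfun (ps_e e f) [::] = ce c e *: pfun f [::].
Proof. by []. Qed.

Lemma pfun_e_cons e f e' es : pfun (ps_e e f) (e' :: es) =
  if (e' == e) && ~~ T (src e) then hd (rng e) es (pfun f es) else 0.
Proof. by []. Qed.

Lemma pfun_g_nil e f :
  pfun (ps_g e f) [::] = pfun f [:: e] + cg c e *: pfun f [::].
Proof. by []. Qed.

Lemma pfun_g_cons e f e' es : pfun (ps_g e f) (e' :: es) = pfun f [:: e, e' & es].
Proof. exact: addr0. Qed.

Lemma pfun_k k f es : pfun (ps_k k f) es = ck c k *: pfun f es.
Proof. by []. Qed.

Lemma path_hd f e es : hd (rng e) es (pfun f (e :: es)) = pfun f (e :: es).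
Proof. by have [/(_ [::] e es)[]] := subgP f. Qed.

Lemma path_T f e es : T (src e) -> pfun f (e :: es) = 0.
Proof. by have [/(_ [::] e es)[]] := subgP f. Qed.

(** A path starting in [cD] stays there, and [cD] avoids [T], so such a path never ends in [T]. *)
Lemma path_D f e es : cD c (src e) -> pfun f (e :: es) = 0.
Proof.
have [+ _] := subgP f; rewrite -/(pfun f); move: (pfun f) => {}f fP.
(* The prefix is generalized so that the splitting condition applies at each later edge. *)
rewrite -[e :: es]cat0s; move: [::] => l.
elim: es => [|e' es IH] in e l *; move=> /cD_rng De.
  by have [<- _] := fP l e [::]; rewrite /= cv_out ?scale0r //; exact: cD_out De.
have [/= + _] := fP l e (e' :: es); case: eqP => [e'e _|//].
by rewrite -cat_rcons; apply: IH; rewrite e'e.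
Qed.

Definition pfunE :=
  (pfunB, pfunD, pfun_v, pfun_e_nil, pfun_e_cons, pfun_g_nil, pfun_g_cons, pfun_k).

Lemma ps_vB v : zmod_morphism (ps_v v).
Proof. by move=> f g; apply: pspaceP => es; rewrite !pfunE raddfB. Qed.

Lemma ps_eB e : zmod_morphism (ps_e e).
Proof.
move=> f g; apply: pspaceP => -[|e' es]; rewrite !pfunE; first exact: scalerBr.
by case: ifP; rewrite ?subr0 // raddfB.
Qed.

Lemma ps_gB e : zmod_morphism (ps_g e).
Proof.
move=> f g; apply: pspaceP => -[|e' es]; rewrite !pfunE //.
by rewrite scalerBr opprD addrACA.
Qed.

Lemma ps_kB k : zmod_morphism (ps_k k).
Proof. by move=> f g; apply: pspaceP => es; rewrite !pfunE scalerBr. Qed.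

Lemma ps_v_v v w f : ps_v v (ps_v w f) = if v == w then ps_v v f else 0.
Proof.
apply: pspaceP => es; rewrite !pfunE hd_hd.
by case: ifP; rewrite ?pfun0.
Qed.

Lemma ps_v_e e f : ps_v (src e) (ps_e e f) = ps_e e f.
Proof.
apply: pspaceP => -[|e' es]; rewrite !pfunE /=; first by rewrite scalerA cv_ce.
by case: (eqVneq e' e) => [->|_] /=; rewrite ?eqxx ?if_same.
Qed.

Lemma ps_e_v e f : ps_e e (ps_v (rng e) f) = ps_e e f.
Proof.
apply: pspaceP => -[|e' es]; rewrite !pfunE /=; first by rewrite scalerA ce_cv.
by rewrite hd_hd eqxx.
Qed.

Lemma ps_v_g e f : ps_v (rng e) (ps_g e f) = ps_g e f.
Proof.
apply: pspaceP => -[|e' es]; rewrite !pfunE ?path_hd //.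
by rewrite -[in RHS](path_hd f e [::]) /= scalerDr [_ *: (cg _ _ *: _)]scalerA cv_cg.
Qed.

Lemma ps_g_v e f : ps_g e (ps_v (src e) f) = ps_g e f.
Proof.
by apply: pspaceP => -[|e' es]; rewrite !pfunE /= eqxx // scalerA cg_cv.
Qed.

(** When [e] starts in [T], the left side lives on the empty path, so [f] must vanish on nontrivial
    paths from [rng e]: by [path_T] if [rng e] is in [T], and by [cD_exit] with [path_D]
    otherwise. *)
Lemma ps_g_e e e1 f :
  ps_g e (ps_e e1 f) = if e == e1 then ps_v (rng e) f else 0.
Proof.
apply: pspaceP => es.
rewrite [RHS](_ : _ = if e == e1 then hd (rng e) es (pfun f es) else 0);
  last by case: ifP => // _; rewrite pfun0.
case: (boolP (T (src e))) => eT; last first.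
  case: es => [|e' es]; rewrite !pfunE ?cg_out // ?scale0r ?addr0.
    by case: eqP => //= <-; rewrite eT.
  by case: eqP => //= <-; rewrite eT.
have eg : (e == e1) && ~~ T (src e1) = false.
  by case: eqP => //= <-; rewrite eT.
case: es => [|e' es]; rewrite !pfunE eg.
  by rewrite add0r scalerA cg_ce //; case: ifP; rewrite ?scale0r.
case: ifP => //= _; case: eqP => // e'e; symmetry.
have [e'T|/(cD_exit c eT)] := boolP (T (rng e)).
  by apply: path_T; rewrite e'e.
by rewrite -e'e; exact: path_D.
Qed.

(** At the empty path this is [cv_sum] for [v] in [T], while both sides vanish for other [v]. At a
    nonempty path only its first edge contributes, and it restores the value. *)
Lemma ps_v_sum v f : ~~ is_sink v ->
  ps_v v f = \sum_(e | src e == v) ps_e e (ps_g e f).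
Proof.
move=> vN; apply: pspaceP => -[|e es]; rewrite pfun_sum !pfunE.
  under eq_bigr => e _ do rewrite !pfunE scalerDr.
  rewrite big_split /= [X in X + _]big1 => [|e _]; last first.
    have [eT|eT] := boolP (T (src e)); first by rewrite path_T ?scaler0.
    by rewrite ce_out ?scale0r.
  rewrite add0r; under eq_bigr => e _ do rewrite scalerA.
  rewrite -scaler_suml; have [vT|vT] := boolP (T v).
    by rewrite -cv_sum.
  rewrite cv_out // big1 // => e /eqP ev.
  by rewrite ce_out ?mul0r // ev.
under eq_bigr => e' _ do rewrite pfunE.
rewrite -big_mkcondr /=.
have [eT|eT] := boolP (T (src e)).
  rewrite path_T // if_same big1 // => e' /andP[_ /andP[/eqP <- ]].
  by rewrite eT.
case: eqP => [ev|ev]; last first.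
  rewrite big1 // => e' /andP[/eqP e'v /andP[/eqP ee' _]].
  by case: ev; rewrite ee'.
rewrite (big_pred1 e) => [|e']; last first.
  rewrite /= [e' == e]eq_sym.
  by case: (eqVneq e e') => [<-|_]; rewrite ?andbF // eT ev eqxx.
case: es => [|e' es]; rewrite pfunE ?path_hd //.
by rewrite cg_out // scale0r addr0 path_hd.
Qed.

Lemma sum_ps_v f : \sum_v ps_v v f = f.
Proof. by apply: pspaceP => es; rewrite pfun_sum; exact: sum_hd. Qed.

Lemma ps_kA a b f : ps_k a (ps_k b f) = ps_k (a * b) f.
Proof. by apply: pspaceP => es; rewrite !pfunE scalerA ckM. Qed.

Lemma ps_k1 f : ps_k 1 f = f.
Proof. by apply: pspaceP => es; rewrite !pfunE ck1 scale1r. Qed.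

Lemma ps_kD a b f : ps_k (a + b) f = ps_k a f + ps_k b f.
Proof. by apply: pspaceP => es; rewrite !pfunE ckD scalerDl. Qed.

Lemma ps_k_v k v f : ps_k k (ps_v v f) = ps_v v (ps_k k f).
Proof. by apply: pspaceP => es; rewrite !pfunE hd_ck. Qed.

Lemma ps_k_e k e f : ps_k k (ps_e e f) = ps_e e (ps_k k f).
Proof.
apply: pspaceP => -[|e' es]; rewrite !pfunE; first by rewrite !scalerA ck_ce.
by case: ifP => _; rewrite ?scaler0 // hd_ck.
Qed.

Lemma ps_k_g k e f : ps_k k (ps_g e f) = ps_g e (ps_k k f).
Proof.
apply: pspaceP => -[|e' es]; rewrite !pfunE //.
by rewrite scalerDr !scalerA ck_cg.
Qed.

Definition path_rep : lpa_rep K E pspace :=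
  LpaRep ps_vB ps_eB ps_gB ps_kB ps_v_v ps_v_e ps_e_v ps_v_g ps_g_v ps_g_e
    ps_v_sum sum_ps_v ps_kA ps_k1 ps_kD ps_k_v ps_k_e ps_k_g.

Definition path_module : lmodType (lpa K E) := rep_module_of path_rep.

Lemma pmod_lv v f : lv K v *: (f : path_module) = ps_v v f.
Proof. exact (@rep_lv K E _ path_rep v f). Qed.

Lemma pmod_le e f : le K e *: (f : path_module) = ps_e e f.
Proof. exact (@rep_le K E _ path_rep e f). Qed.

Lemma pmod_lg e f : lg K e *: (f : path_module) = ps_g e f.
Proof. exact (@rep_lg K E _ path_rep e f). Qed.

Lemma pmod_lk k f : lk E k *: (f : path_module) = ps_k k f.
Proof. exact (@rep_lk K E _ path_rep k f). Qed.

Definition fun_inc n (es : seq (edge E)) : N := if es is [::] then n else 0.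

Lemma path_fun_inc n : path_fun (fun_inc n).
Proof.
split=> [l e es|_]; last by exists 1%N; case.
by rewrite /fun_inc; case: l => [|? ?] /=; rewrite raddf0.
Qed.

Definition ps_inc n : pspace := @mksub _ path_fun_subgroup _ (path_fun_inc n).

Lemma pfun_inc n es : pfun (ps_inc n) es = if es is [::] then n else 0.
Proof. by []. Qed.

Lemma ps_v_T v f : T v -> ps_v v f = ps_inc (cv c v *: pfun f [::]).
Proof.
move=> vT; apply: pspaceP => -[|e es]; rewrite pfun_inc pfun_v //=.
by case: eqP => // ev; rewrite path_T // ev.
Qed.

Lemma ps_inc_B : zmod_morphism ps_inc.
Proof.
by move=> n n'; apply: pspaceP => -[|e es]; rewrite pfunB !pfun_inc ?subr0.
Qed.

Lemma ps_inc_v v n : ps_inc (cv c v *: n) = ps_v v (ps_inc n).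
Proof.
by apply: pspaceP => -[|e es]; rewrite !pfunE !pfun_inc //= if_same.
Qed.

Lemma ps_inc_e e n : T (src e) -> ps_inc (ce c e *: n) = ps_e e (ps_inc n).
Proof.
by move=> eT; apply: pspaceP => -[|e' es]; rewrite !pfunE !pfun_inc // eT andbF.
Qed.

Lemma ps_inc_g e n : ps_inc (cg c e *: n) = ps_g e (ps_inc n).
Proof.
by apply: pspaceP => -[|e' es]; rewrite !pfunE !pfun_inc // add0r.
Qed.

Lemma ps_inc_k k n : ps_inc (ck c k *: n) = ps_k k (ps_inc n).
Proof.
by apply: pspaceP => -[|e' es]; rewrite !pfunE !pfun_inc // scaler0.
Qed.

Lemma ps_g_notT e f es : ~~ T (src e) -> pfun (ps_g e f) es = pfun f (e :: es).
Proof.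
by move=> eT; case: es => [|e' es]; rewrite !pfunE // cg_out // scale0r addr0.
Qed.

(** Iterated, this writes a function of bounded length as a finite sum of paths applied to elements
    on the empty path; maps out of path modules are constructed and compared by this recursion. *)
Lemma ps_expand f :
  f = ps_inc (pfun f [::]) + \sum_(e | ~~ T (src e)) ps_e e (ps_g e f).
Proof.
apply: pspaceP => -[|e es]; rewrite !pfunE pfun_sum pfun_inc.
  rewrite big1 ?addr0 // => e eT.
  by rewrite !pfunE ce_out // scale0r.
rewrite add0r; have [eT|eT] := boolP (T (src e)).
  rewrite path_T // big1 // => e' e'T; rewrite pfunE.
  by case: eqP => // ee'; rewrite -ee' eT in e'T.
rewrite (bigD1 e) //= big1 ?addr0 => [|e' /andP[_ e'e]]; last first.
  by rewrite pfunE eq_sym (negPf e'e).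
by rewrite pfunE eqxx eT ps_g_notT // path_hd.
Qed.

Definition path_bound m f := forall es, (m <= size es)%N -> pfun f es = 0.

Lemma path_bound_leq m m' f :
  (m <= m')%N -> path_bound m f -> path_bound m' f.
Proof. by move=> mm' fm es /(leq_trans mm')/fm. Qed.

Lemma path_bound_g m e f :
  ~~ T (src e) -> path_bound m.+1 f -> path_bound m (ps_g e f).
Proof. by move=> eT fm es mes; rewrite ps_g_notT // fm. Qed.

Lemma path_bound0 f : path_bound 0 f -> f = 0.
Proof. by move=> f0; apply: pspaceP => es; rewrite f0 // pfun0. Qed.

End Space.

Lemma hd_linear (N N' : lmodType R) (h : {linear N -> N'}) v es n :
  hd v es (h n) = h (hd v es n).
Proof.
case: es => [|e es] /=; first by rewrite linearZ.
by case: ifP; rewrite ?linear0.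
Qed.

Section Functor.
Variables (N N' : lmodType R) (h : {linear N -> N'}).

Lemma path_fun_map (f : pspace N) : path_fun (h \o pfun f).
Proof.
have [f1 f2] := subgP f; split=> [l e es|fi] /=.
  have [fE fT] := f1 l e es; rewrite hd_linear [hd _ _ _]fE; split=> // eT.
  by rewrite [pfun f _]fT // linear0.
by have [m fm] := f2 fi; exists m => es /fm; rewrite /pfun => ->; rewrite linear0.
Qed.

Definition ps_map (f : pspace N) : pspace N' :=
  @mksub _ (path_fun_subgroup N') _ (path_fun_map f).

Lemma pfun_map f es : pfun (ps_map f) es = h (pfun f es).
Proof. by []. Qed.

Lemma ps_mapB : zmod_morphism ps_map.
Proof.
by move=> f g; apply: pspaceP => es; rewrite pfunB !pfun_map pfunB linearB.
Qed.

Lemma ps_map_inc n : ps_map (ps_inc n) = ps_inc (h n).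
Proof.
by apply: pspaceP => -[|e es]; rewrite pfun_map !pfun_inc // linear0.
Qed.

Definition path_map0 : path_module N -> path_module N' := ps_map.
HB.instance Definition _ := GRing.isZmodMorphism.Build
  (path_module N) (path_module N') path_map0 ps_mapB.

Lemma path_map_linear : linear path_map0.
Proof.
apply: lpa_linear => [v f|e f|e f|k f].
- rewrite !pmod_lv; apply: pspaceP => es.
  by rewrite pfun_map !pfun_v pfun_map hd_linear.
- rewrite !pmod_le; apply: pspaceP => -[|e' es]; rewrite pfun_map !pfunE.
    by rewrite linearZ.
  by rewrite pfun_map; case: ifP; rewrite ?linear0 // hd_linear.
- rewrite !pmod_lg; apply: pspaceP => -[|e' es].
    by rewrite pfun_map !pfunE !pfun_map linearD linearZ.
  by rewrite pfun_map !pfunE !pfun_map.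
- rewrite !pmod_lk; apply: pspaceP => es.
  by rewrite pfun_map !pfun_k pfun_map linearZ.
Qed.

Definition path_map : {linear path_module N -> path_module N'} :=
  mklin path_map_linear.

End Functor.

Lemma path_map1 (N : Mod R) : path_map (idm N) = idm (path_module N : Mod _).
Proof. by apply: linear_funext => f; apply: pspaceP. Qed.

Lemma path_mapM (N N' N'' : Mod R) (g : hom N' N'') (h : hom N N') :
  path_map (mcomp g h) = mcomp (path_map g : @hom (Mod (lpa K E)) _ _) (path_map h).
Proof. by apply: linear_funext => f; apply: pspaceP. Qed.

Definition path_functor : functor (Mod R) (Mod (lpa K E)) :=
  @Functor (Mod R) (Mod (lpa K E)) path_module path_map path_map1 path_mapM.

End PathModule.

(** * Linear maps out of a path module *)

Section Extension.
Variables (K : fieldType) (E : digraph) (T : pred (vertex E)) (R : pzRingType).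
Variables (c : corner_data K T R) (fin : bool) (N : lmodType R).
Variable M : lmodType (lpa K E).
Local Notation pspace := (pspace c fin N).
Local Notation path_module := (path_module c fin N).
Implicit Types (f : pspace) (n : N).

Lemma path_module_eq (h h' : {linear path_module -> M}) :
  (forall f, exists m, path_bound m f) ->
  (forall n, h (ps_inc c fin n) = h' (ps_inc c fin n)) -> h =1 h'.
Proof.
move=> bnd hh' f; have [m] := bnd f; elim: m f => [|m IH] f fm.
  by rewrite (path_bound0 fm) !linear0.
rewrite (ps_expand f) (linearD h) (linearD h') hh'; congr (_ + _).
rewrite !linear_sum; apply: eq_bigr => e eT.
by rewrite -!pmod_le !linearZ /= IH //; exact: path_bound_g.
Qed.

Variable g : {additive N -> M}.
Hypothesis bnd : forall f, exists m, path_bound m f.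
Hypothesis g_v : forall v n, g (cv c v *: n) = lv K v *: g n.
Hypothesis g_e : forall e n, T (src e) -> g (ce c e *: n) = le K e *: g n.
Hypothesis g_g : forall e n, T (src e) -> g (cg c e *: n) = lg K e *: g n.
Hypothesis g_k : forall k n, g (ck c k *: n) = lk E k *: g n.

(* The sum of [p *: g (f p)] over the paths [p] of length less than [m]. *)
Fixpoint ext_rec m f : M :=
  if m is m'.+1 then g (pfun f [::]) +
    \sum_(e | ~~ T (src e)) le K e *: ext_rec m' (ps_g e f)
  else 0.

Lemma ext_recB m : zmod_morphism (ext_rec m).
Proof.
elim: m => [|m IH] f f' /=; first by rewrite subr0.
rewrite pfunB raddfB opprD addrACA -sumrB; congr (_ + _).
by apply: eq_bigr => e _; rewrite ps_gB IH scalerBr.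
Qed.

HB.instance Definition _ m := GRing.isZmodMorphism.Build pspace M (ext_rec m)
  (ext_recB m).

(** Beyond the bound only zero terms are added, so the value of [ext] does not depend on the bound
    it chooses. *)
Lemma ext_rec_leq m m' f :
  path_bound m f -> (m <= m')%N -> ext_rec m' f = ext_rec m f.
Proof.
elim: m m' f => [|m IH] m' f fm.
  by rewrite (path_bound0 fm) !raddf0.
case: m' => [//|m'] /= mm'; congr (_ + _); apply: eq_bigr => e eT.
by rewrite (IH m') //; exact: path_bound_g.
Qed.

Definition ext f : M := ext_rec (projT1 (cid (bnd f))) f.

Lemma extE m f : path_bound m f -> ext f = ext_rec m f.
Proof.
rewrite /ext; case: cid => m' /= fm' fm.
by rewrite -(ext_rec_leq fm (leq_maxl m m')) -(ext_rec_leq fm' (leq_maxr m m')).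
Qed.

(** The common bound is a successor so that [ext_rec] unfolds once. *)
Lemma ext_bound f f' : exists m, path_bound m.+1 f /\ path_bound m.+1 f'.
Proof.
have [m fm] := bnd f; have [m' fm'] := bnd f'; exists (maxn m m').
by split; [apply: path_bound_leq fm|apply: path_bound_leq fm'];
  rewrite leqW // ?leq_maxl ?leq_maxr.
Qed.

Lemma extB : zmod_morphism ext.
Proof.
move=> f f'; have [m [fm fm']] := ext_bound f f'.
rewrite (extE fm) (extE fm') -raddfB; apply: extE => es mes.
by rewrite pfunB fm // fm' // subr0.
Qed.

Lemma ext_inc n : ext (ps_inc c fin n) = g n.
Proof.
rewrite (@extE 1) => [|[]//].
by rewrite /= big1 ?addr0 // => e _; rewrite scaler0.
Qed.

Lemma ps_g_v_eq e v f :
  ps_g e (ps_v v f) = if src e == v then ps_g e f else 0.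
Proof.
by rewrite -ps_g_v ps_v_v; case: ifP; rewrite ?ps_g_v // -pmod_lg scaler0.
Qed.

Lemma ext_v v f : ext (ps_v v f) = lv K v *: ext f.
Proof.
have [m [fm fm']] := ext_bound f (ps_v v f).
rewrite (extE fm) (extE fm') /= pfun_v g_v scalerDr scaler_sumr.
congr (_ + _); apply: eq_bigr => e _; rewrite scalerA lv_le_eq ps_g_v_eq.
by case: ifP; rewrite ?scale0r ?raddf0 ?scaler0.
Qed.

Lemma ext_g e f : ext (ps_g e f) = lg K e *: ext f.
Proof.
have [m [fm fm']] := ext_bound f (ps_g e f).
rewrite (extE fm) /= scalerDr scaler_sumr.
have [eT|eT] := boolP (T (src e)).
  rewrite [X in _ + X]big1 => [|e' e'T]; last first.
    rewrite scalerA lg_le; case: eqP => [ee'|]; last by rewrite scale0r.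
    by rewrite -ee' eT in e'T.
  rewrite addr0 -g_g // (extE fm') /= pfun_g_nil path_T // add0r.
  rewrite big1 ?addr0 // => e' e'T.
  rewrite (_ : ps_g e' _ = 0) ?raddf0 ?scaler0 //; apply: pspaceP => es.
  by rewrite ps_g_notT // pfun_g_cons path_T // pfun0.
rewrite (bigD1 e) //= big1 ?addr0 => [|e' /andP[_ e'e]]; last first.
  by rewrite scalerA lg_le eq_sym (negPf e'e) scale0r.
(* The term from the empty path drops out: the ghost edge factors through [src e], which is outside
   [T] and kills the image of [g]. *)
rewrite -[lg K e]lg_lv -scalerA -g_v cv_out // scale0r raddf0 scaler0 add0r.
rewrite lg_lv scalerA lg_le eqxx -(@extE m); last exact: path_bound_g.
by rewrite -ext_v ps_v_g.
Qed.

Lemma ext_e e f : ext (ps_e e f) = le K e *: ext f.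
Proof.
have [m [fm fm']] := ext_bound f (ps_e e f).
rewrite (extE fm') /= pfun_e_nil; have [eT|eT] := boolP (T (src e)).
  rewrite big1 ?addr0 => [|e' e'T]; last first.
    rewrite ps_g_e; case: eqP => [e'e|]; last by rewrite raddf0 scaler0.
    by rewrite e'e eT in e'T.
  rewrite g_e // (extE fm) /= scalerDr scaler_sumr big1 ?addr0 // => e' e'T.
  rewrite scalerA -[le K e]le_lv -mulrA lv_le_eq.
  case: eqP => [e'e|]; last by rewrite mulr0 scale0r.
  (* Here [e'] continues an edge that has left [T], so no path beginning with [e'] comes back to
     [T]. *)
  have De' : cD c (src e').
    by rewrite e'e; apply: (cD_exit c eT); rewrite -e'e.
  rewrite (_ : ps_g e' f = 0) ?raddf0 ?scaler0 //; apply: pspaceP => es.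
  by rewrite ps_g_notT // path_D // pfun0.
rewrite ce_out // scale0r raddf0 add0r (bigD1 e) //= big1 ?addr0; last first.
  by move=> e' /andP[_ e'e]; rewrite ps_g_e (negPf e'e) raddf0 scaler0.
rewrite -(@extE m); last exact: path_bound_g.
by rewrite ps_g_e eqxx ext_v scalerA le_lv.
Qed.

Lemma ext_k k f : ext (ps_k k f) = lk E k *: ext f.
Proof.
have [m [fm fm']] := ext_bound f (ps_k k f).
rewrite (extE fm) (extE fm') {fm fm'}; elim: m.+1 f => {m} [|m IH] f /=.
  by rewrite scaler0.
rewrite pfun_k g_k scalerDr scaler_sumr; congr (_ + _); apply: eq_bigr => e _.
by rewrite -ps_k_g IH !scalerA lk_comm.
Qed.

Definition ext0 : path_module -> M := ext.
HB.instance Definition _ := GRing.isZmodMorphism.Build path_module M ext0 extB.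

Lemma ext_linear : linear ext0.
Proof.
apply: lpa_linear => [v f|e f|e f|k f].
- by rewrite pmod_lv; exact: ext_v.
- by rewrite pmod_le; exact: ext_e.
- by rewrite pmod_lg; exact: ext_g.
- by rewrite pmod_lk; exact: ext_k.
Qed.

Definition extl : {linear path_module -> M} := mklin ext_linear.

Lemma extl_inc n : extl (ps_inc c fin n) = g n.
Proof. exact: ext_inc. Qed.

(** The kernel is a submodule. On it the value at the empty path vanishes, because each vertex of
    [T] moves that value into the image of [g]; ghost edges bring the value at any other path to the
    empty one. *)
Lemma extl_inj : injective g -> injective extl.
Proof.
move=> gI; apply: raddf_inj => f f0; apply: pspaceP => es; rewrite pfun0.
have base (f' : path_module) : extl f' = 0 -> pfun f' [::] = 0.
  move=> f'0; rewrite -[LHS]scale1r -(sum_cv c) scaler_suml big1 // => v _.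
  have [vT|vT] := boolP (T v); last by rewrite cv_out ?scale0r.
  apply: gI; rewrite raddf0 -extl_inc -ps_v_T // -pmod_lv.
  by rewrite linearZ_LR f'0 scaler0.
elim: es => [|e es IH] in f f0 *; first exact: base.
have gf0 : extl (ps_g e f) = 0 by rewrite -pmod_lg linearZ_LR f0 scaler0.
have := IH _ gf0; case: es {IH} => [|e' es]; rewrite pfunE //.
by rewrite base // scaler0 addr0.
Qed.

End Extension.

Lemma pspace_bounded (K : fieldType) (E : digraph) (T : pred (vertex E))
    (R : pzRingType) (c : corner_data K T R) (N : lmodType R)
    (f : pspace c true N) : exists m, path_bound m f.
Proof. by have [_ /(_ isT)] := subgP f. Qed.

(** * Linear maps into a path module *)

Section Coextension.
Variables (K : fieldType) (E : digraph) (T : pred (vertex E)) (R : pzRingType).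
Variables (c : corner_data K T R) (N : lmodType R).
Variable M : lmodType (lpa K E).
Local Notation pspace := (pspace c false N).
Local Notation path_module := (path_module c false N).
Hypothesis noT : forall e : edge E, ~~ T (src e).

(** The value of a function at [e :: es] is the value at [es] of its multiple by the ghost of [e],
    so linear maps are determined by the values at the empty path. *)
Lemma to_path_module_eq (h h' : {linear M -> path_module}) :
  (forall m, pfun (h m) [::] = pfun (h' m) [::]) -> h =1 h'.
Proof.
move=> hh' m; apply: pspaceP => es; elim: es m => [//|e es IH] m.
by rewrite -!(ps_g_notT (c := c)) // -!pmod_lg -!linearZ /= IH.
Qed.

Variable g : {additive M -> N}.
Hypothesis g_v : forall v m, g (lv K v *: m) = cv c v *: g m.
Hypothesis g_k : forall k m, g (lk E k *: m) = ck c k *: g m.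

(** This is p^* m for the path p = [es]: the ghost of the first edge acts first. The coextension of
    [g] sends [m] to the function with value g(p^* m) at p. *)
Definition ghosts (m : M) es := foldl (fun m e => lg K e *: m) m es.

Lemma ghosts0 es : ghosts 0 es = 0.
Proof. by elim: es => [//|e es IH] /=; rewrite scaler0. Qed.

Lemma ghostsB es : zmod_morphism (ghosts^~ es).
Proof.
elim: es => [//|e es IH] m m' /=.
by rewrite -IH -scalerBr.
Qed.

Definition coext_fun (m : M) es := g (ghosts m es).

Lemma hd_coext v m es :
  hd c v es (coext_fun m es) = coext_fun (lv K v *: m) es.
Proof.
rewrite /coext_fun; case: es => [|e es] /=; first by rewrite g_v.
rewrite scalerA lg_lv_eq; case: ifP => // _.
by rewrite scale0r ghosts0 raddf0.
Qed.

Lemma coext_cat m l es : coext_fun m (l ++ es) = coext_fun (ghosts m l) es.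
Proof. by rewrite /coext_fun /ghosts foldl_cat. Qed.

Lemma path_fun_coext m : path_fun c false (coext_fun m).
Proof.
split=> // l e es; split; last by rewrite (negPf (noT e)).
rewrite coext_cat -[coext_fun _ (e :: es)]/(coext_fun (lg K e *: ghosts m l) es).
by rewrite hd_coext scalerA lv_lg.
Qed.

Definition coext (m : M) : path_module :=
  @mksub _ (path_fun_subgroup c false N) _ (path_fun_coext m).

Lemma pfun_coext m es : pfun (coext m) es = g (ghosts m es).
Proof. by []. Qed.

Lemma coextB : zmod_morphism coext.
Proof.
by move=> m m'; apply: pspaceP => es; rewrite pfunB !pfun_coext ghostsB raddfB.
Qed.

HB.instance Definition _ := GRing.isZmodMorphism.Build M path_module coext coextB.

Lemma coext_linear : linear coext.
Proof.
apply: lpa_linear => [v m|e m|e m|k m].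
- rewrite pmod_lv; apply: pspaceP => es.
  by rewrite pfun_v pfun_coext [RHS]hd_coext.
- rewrite pmod_le; apply: pspaceP => -[|e' es].
    by rewrite pfun_e_nil ce_out // scale0r pfun_coext /= -lv_le -scalerA g_v cv_out ?scale0r.
  rewrite pfun_e_cons noT andbT [hd _ _ _ _]hd_coext pfun_coext /= scalerA lg_le.
  by case: eqP => [->|] //; rewrite scale0r ghosts0 raddf0.
- rewrite pmod_lg; apply: pspaceP => es.
  by rewrite ps_g_notT.
- rewrite pmod_lk; apply: pspaceP => es.
  rewrite pfun_k !pfun_coext -g_k; congr (g _).
  elim: es => [//|e es IH] in m *.
  by rewrite /= -IH !scalerA lk_comm.
Qed.

Definition coextl : {linear M -> path_module} := mklin coext_linear.

Lemma coextl_nil m : pfun (coextl m) [::] = g m.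
Proof. by []. Qed.

End Coextension.

(** A nonempty path in the support would start at a vertex outside [T] that does not kill [f]. Hence
    the part of a path module at [T] is a copy of [N]. *)
Lemma corner_inc (K : fieldType) (E : digraph) (T : pred (vertex E))
    (R : pzRingType) (c : corner_data K T R) fin (N : lmodType R)
    (f : pspace c fin N) :
  (forall v, ~~ T v -> ps_v v f = 0) -> f = ps_inc c fin (pfun f [::]).
Proof.
move=> fT; apply: pspaceP => -[//|e es]; rewrite pfun_inc.
have [eT|/fT e0] := boolP (T (src e)); first by rewrite path_T.
by have := pfun_v (src e) f (e :: es); rewrite e0 pfun0 /= eqxx.
Qed.

Lemma sum_sub (V : nmodType) (I : finType) (P Q : pred I) (F : I -> V) :
  (forall i, ~~ P i -> F i = 0) ->
  \sum_(i | Q i) F i = \sum_(i : {i | P i} | Q (val i)) F (val i).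
Proof.
move=> F0; rewrite (bigID P) /= [X in _ + X]big1 ?addr0; last first.
  by move=> i /andP[_ /F0].
rewrite (reindex_omap (val : {i | P i} -> I) insub) /=.
  by apply: eq_bigl => i; rewrite valK eqxx (valP i) !andbT.
by move=> i /andP[_ Pi]; rewrite insubT.
Qed.

(** * The quotient functor and its adjoints *)

Section Sinks.
Variables (K : fieldType) (E : digraph).
Local Notation A := (lpa K E).
Local Notation C := {ffun sinks E -> K}.
Implicit Types (v : vertex E) (w : sinks E).

Definition sink_idem v : C := [ffun w => (val w == v)%:R].
Definition sink_const (k : K) : C := [ffun=> k].

Lemma sink_src (e : edge E) : ~~ is_sink (src e).
Proof. by apply/forallPn; exists e; rewrite negbK. Qed.

Lemma sink_idem_out v : ~~ is_sink v -> sink_idem v = 0.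
Proof.
move=> vN; apply/ffunP => w; rewrite !ffunE; case: eqP => // wv.
by have := valP w; rewrite wv (negPf vN).
Qed.

Lemma sink_idemM v v' :
  sink_idem v * sink_idem v' = if v == v' then sink_idem v else 0.
Proof.
apply/ffunP => w; rewrite ffunE; case: (eqVneq v v') => [<-|vv'].
  by rewrite !ffunE; case: eqP; rewrite ?mulr1 ?mulr0.
rewrite !ffunE; case: eqP => [->|]; last by rewrite mul0r.
by rewrite (negPf vv') mulr0.
Qed.

Lemma sum_sink_idem : \sum_v sink_idem v = 1.
Proof.
apply/ffunP => w; rewrite sum_ffunE !ffunE (bigD1 (val w)) //= ffunE eqxx.
by rewrite big1 ?addr0 // => v /negPf vw; rewrite ffunE eq_sym vw.
Qed.

Lemma sink_decomp (a : C) :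
  a = \sum_w sink_const (a w) * sink_idem (val w).
Proof.
apply/ffunP => w; rewrite sum_ffunE (bigD1 w) //= !ffunE eqxx mulr1.
rewrite big1 ?addr0 // => w' w'w; rewrite !ffunE.
by rewrite (inj_eq val_inj) eq_sym (negPf w'w) mulr0.
Qed.

(** No edge starts at a sink, so all edges act as zero and [cD] may be empty. *)
Definition sink_data : corner_data K (@is_sink E) C.
Proof.
refine (@CornerData K E (@is_sink E) C sink_idem (fun=> 0) (fun=> 0)
  sink_const sink_idem_out _ _ sink_idemM _ _ _ _ _ _ sum_sink_idem _ _ _ _ _ _
  (fun=> False) _ _ _) => //.
- by move=> e; rewrite mulr0.
- by move=> e; rewrite mul0r.
- by move=> e; rewrite mulr0.
- by move=> e; rewrite mul0r.
- by move=> e f eT; have := sink_src e; rewrite eT.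
- by move=> v ->.
- by move=> a b; apply/ffunP => w; rewrite !ffunE.
- by move=> a b; apply/ffunP => w; rewrite !ffunE.
- by move=> k v; apply/ffunP => w; rewrite !ffunE mulrC.
- by move=> k e; rewrite mulr0 mul0r.
- by move=> k e; rewrite mulr0 mul0r.
- by move=> e eT; have := sink_src e; rewrite eT.
Defined.

Section Object.
Variable M : lmodType A.

(** As the vertices are orthogonal idempotents with sum one, this describes eM, for e the sum of the
    sinks. *)
Definition in_corner (m : M) := forall v, ~~ is_sink v -> lv K v *: m = 0.

Lemma in_corner0 : in_corner 0. Proof. by move=> v _; rewrite scaler0. Qed.

Lemma in_cornerB x y : in_corner x -> in_corner y -> in_corner (x - y).
Proof. by move=> xC yC v vN; rewrite scalerBr xC // yC // subr0. Qed.

Definition corner_subgroup := Subgroup in_corner0 in_cornerB.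
Definition corner := subg corner_subgroup.
HB.instance Definition _ := GRing.Zmodule.on corner.

Lemma in_corner_lv (m : M) w : in_corner (lv K (val w) *: m).
Proof.
move=> v vN; rewrite scalerA lvM; case: eqP => [vw|]; last by rewrite scale0r.
by rewrite vw (valP w) in vN.
Qed.

Lemma in_corner_sum I r (P : pred I) (F : I -> M) :
  (forall i, in_corner (F i)) -> in_corner (\sum_(i <- r | P i) F i).
Proof.
by move=> FC v vN; rewrite scaler_sumr big1 // => i _; exact: FC.
Qed.

Lemma in_corner_lk k (m : M) : in_corner m -> in_corner (lk E k *: m).
Proof.
by move=> mC v vN; rewrite scalerA -lk_comm -scalerA mC // scaler0.
Qed.

Definition sink_act (a : C) (m : M) : M :=
  \sum_w lk E (a w) *: (lv K (val w) *: m).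

Lemma in_corner_sink_act a m : in_corner (sink_act a m).
Proof.
by apply: in_corner_sum => w; apply: in_corner_lk; exact: in_corner_lv.
Qed.

Definition corner_scale (a : C) (m : corner) : corner :=
  @mksub _ corner_subgroup _ (in_corner_sink_act a (val m)).

Lemma lv_sink_act a w m :
  lv K (val w) *: sink_act a m = lk E (a w) *: (lv K (val w) *: m).
Proof.
rewrite /sink_act scaler_sumr (bigD1 w) //= big1 ?addr0 => [|w' w'w].
  by rewrite scalerA -lk_comm -scalerA; congr (_ *: _); rewrite scalerA lvM eqxx.
rewrite scalerA -lk_comm -scalerA [lv _ _ *: (_ *: _)]scalerA lvM.
case: eqP => [ww'|_]; last by rewrite scale0r scaler0.
by rewrite (val_inj (ww' : val w = val w')) eqxx in w'w.
Qed.

Lemma corner_scaleA a b m :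
  corner_scale a (corner_scale b m) = corner_scale (a * b) m.
Proof.
apply: val_inj; apply: eq_bigr => w _.
by rewrite lv_sink_act ffunE -lkM scalerA.
Qed.

Lemma sum_sink_lv m : in_corner m -> \sum_(w : sinks E) lv K (sval w) *: m = m.
Proof.
move=> mC; rewrite -[RHS]sum_lv_scale; symmetry.
exact: (@sum_sub _ _ (@is_sink E) xpredT (fun v => lv K v *: m) mC).
Qed.

Lemma corner_scale1 : left_id 1 corner_scale.
Proof.
move=> m; apply: val_inj; rewrite -[RHS](sum_sink_lv (subgP m)).
by apply: eq_bigr => w _; rewrite ffunE lk1 scale1r.
Qed.

Lemma corner_scaleDr : right_distributive corner_scale +%R.
Proof.
move=> a x y; apply: val_inj; rewrite /= -big_split; apply: eq_bigr => w _ /=.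
by rewrite -!scalerDr.
Qed.

Lemma corner_scaleDl m : {morph corner_scale^~ m : a b / a + b}.
Proof.
move=> a b; apply: val_inj; rewrite /= -big_split; apply: eq_bigr => w _ /=.
by rewrite ffunE lkD scalerDl.
Qed.

HB.instance Definition _ := GRing.Zmodule_isLmodule.Build C corner
  corner_scaleA corner_scale1 corner_scaleDr corner_scaleDl.

Lemma val_corner_lv v (m : corner) :
  val (sink_idem v *: m) = lv K v *: val m.
Proof.
have [vT|vN] := boolP (is_sink v); last first.
  by rewrite (subgP m v vN) sink_idem_out // scale0r.
pose w : sinks E := exist _ v vT.
rewrite -[LHS]/(sink_act _ _) /sink_act (bigD1 w) //= big1 ?addr0.
  by rewrite ffunE eqxx lk1 scale1r.
move=> w' w'w; rewrite ffunE -[v]/(val w) (inj_eq val_inj) (negPf w'w).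
by rewrite lk0 scale0r.
Qed.

Lemma val_corner_lk k (m : corner) : val (sink_const k *: m) = lk E k *: val m.
Proof.
rewrite -[LHS]/(sink_act _ _) -[in RHS](sum_sink_lv (subgP m)) scaler_sumr.
by apply: eq_bigr => w _; rewrite ffunE.
Qed.

End Object.

Lemma corner_linear (M : lmodType C) (M' : lmodType C) (f : {additive M -> M'}) :
  (forall v m, f (sink_idem v *: m) = sink_idem v *: f m) ->
  (forall k m, f (sink_const k *: m) = sink_const k *: f m) -> linear f.
Proof.
move=> fv fk a x y; rewrite raddfD; congr (_ + _).
rewrite (sink_decomp a) !scaler_suml raddf_sum.
by apply: eq_bigr => w _; rewrite -!scalerA fk fv.
Qed.

Section Map.
Variables (M M' : lmodType A) (h : {linear M -> M'}).

Lemma in_corner_map (m : corner M) : in_corner (h (val m)).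
Proof. by move=> v vN; rewrite -linearZ_LR (subgP m) // linear0. Qed.

Definition corner_map0 (m : corner M) : corner M' :=
  @mksub _ (corner_subgroup M') _ (in_corner_map m).

Lemma corner_map_linear : linear corner_map0.
Proof.
move=> a x y; apply: val_inj.
rewrite -[LHS]/(h (sink_act a (val x) + val y)) linearD; congr (_ + _).
by rewrite linear_sum; apply: eq_bigr => w _; rewrite !linearZ_LR.
Qed.

Definition corner_map : {linear corner M -> corner M'} := mklin corner_map_linear.

End Map.

Lemma corner_map1 (M : Mod A) : corner_map (idm M) = idm (corner M : Mod C).
Proof. by apply: linear_funext => m; apply: val_inj. Qed.

Lemma corner_mapM (M M' M'' : Mod A) (g : hom M' M'') (h : hom M M') :
  corner_map (mcomp g h) = mcomp (corner_map g : @hom (Mod C) _ _) (corner_map h).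
Proof. by apply: linear_funext => m; apply: val_inj. Qed.

Definition corner_functor : functor (Mod A) (Mod C) :=
  @Functor (Mod A) (Mod C) (fun M => corner M) corner_map corner_map1 corner_mapM.

End Sinks.

(** * The left and right adjoints of the quotient functor *)

Section SinkAdjunctions.
Variables (K : fieldType) (E : digraph).
Local Notation A := (lpa K E).
Local Notation C := {ffun sinks E -> K}.
Local Notation c := (sink_data K E).
Local Notation j := (corner_functor K E).

Section Corner.
Variables (fin : bool) (V : lmodType C).

Lemma in_corner_inc (n : V) : in_corner (ps_inc c fin n : path_module c fin V).
Proof.
move=> v vN; rewrite pmod_lv -ps_inc_v (cv_out c vN) scale0r.
by apply: pspaceP => -[|e es]; rewrite pfun_inc pfun0.
Qed.

Definition corner_inc0 (n : V) : corner (path_module c fin V) :=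
  @mksub _ (corner_subgroup _) _ (in_corner_inc n).

Lemma corner_inc0B : zmod_morphism corner_inc0.
Proof. by move=> n n'; apply: val_inj; exact: (ps_inc_B c fin). Qed.

HB.instance Definition _ := GRing.isZmodMorphism.Build V
  (corner (path_module c fin V)) corner_inc0 corner_inc0B.

Lemma corner_inc0_linear : linear corner_inc0.
Proof.
apply: corner_linear => [v n|k n]; apply: val_inj.
  by rewrite val_corner_lv pmod_lv -ps_inc_v.
by rewrite val_corner_lk pmod_lk -ps_inc_k.
Qed.

Definition corner_incl : {linear V -> corner (path_module c fin V)} :=
  mklin corner_inc0_linear.

Lemma corner_val_inc (f : corner (path_module c fin V)) :
  f = corner_incl (pfun (val f) [::]).
Proof.
apply: val_inj; rewrite {1}(corner_inc (f := val f)) // => v vN.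
by rewrite -pmod_lv (subgP f).
Qed.

Lemma corner_incl_invertible : @invertible (Mod C) _ _ corner_incl.
Proof.
apply: invertible_linear => [n n' /(congr1 val)|f]; last first.
  by exists (pfun (val f) [::]); rewrite -corner_val_inc.
by move=> /(congr1 (fun f : pspace c fin V => pfun f [::])).
Qed.

Definition corner_nil (f : corner (path_module c fin V)) : V :=
  pfun (val f) [::].

Lemma corner_incK : cancel corner_incl corner_nil.
Proof. by []. Qed.

Lemma corner_nil_linear : linear corner_nil.
Proof.
move=> a f g; rewrite [f]corner_val_inc [g]corner_val_inc.
by rewrite -linearP !corner_incK.
Qed.

Definition corner_nill : {linear corner (path_module c fin V) -> V} :=
  mklin corner_nil_linear.

Lemma corner_nill_invertible : @invertible (Mod C) _ _ corner_nill.
Proof.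
exists corner_incl; split; apply: linear_funext => // f.
by rewrite [RHS]corner_val_inc.
Qed.

End Corner.

Section Left.
Local Notation s := (path_functor c true).

Lemma sink_unit_nat (V V' : Mod C) (a : hom V V') :
  mcomp (corner_incl true V' : hom V' (j (s V'))) a =
  mcomp (fmap j (fmap s a)) (corner_incl true V).
Proof.
apply: linear_funext => n; apply: val_inj.
exact: (esym (ps_map_inc c true a n)).
Qed.

Lemma sink_unit_univ (V : Mod C) (M : Mod A) (h : hom V (j M)) :
  exists! g : hom (s V) M,
    mcomp (fmap j g) (corner_incl true V : hom V (j (s V))) = h.
Proof.
pose g : {additive V -> M} := val \o (h : {linear V -> corner M}).
have g_v v n : g (cv c v *: n) = lv K v *: g n.
  by rewrite /g /= linearZ_LR val_corner_lv.
have g_k k n : g (ck c k *: n) = lk E k *: g n.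
  by rewrite /g /= linearZ_LR val_corner_lk.
have g_e e n : is_sink (src e) -> g (ce c e *: n) = le K e *: g n.
  by rewrite (negPf (sink_src e)).
have g_g e n : is_sink (src e) -> g (cg c e *: n) = lg K e *: g n.
  by rewrite (negPf (sink_src e)).
pose G : {linear path_module c true V -> M} :=
  extl (@pspace_bounded _ _ _ _ c V) g_v g_e g_g g_k.
exists G; split.
  apply: linear_funext => n; apply: (@val_inj _ _ (corner M)).
  exact (extl_inc _ g_v g_e g_g g_k n).
move=> G' /linear_eq hG'; apply: linear_funext.
apply: path_module_eq => [|n]; first exact: pspace_bounded.
by rewrite extl_inc /g /= -hG'.
Qed.

Lemma sink_left_adjoint : left_adjoint s j.
Proof. exact: left_adjoint_unit sink_unit_nat sink_unit_univ. Qed.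

Lemma sink_left_ff : fully_faithful s.
Proof.
apply: (fully_faithful_unit sink_unit_nat sink_unit_univ) => V.
exact: corner_incl_invertible.
Qed.

End Left.

Section Right.
Local Notation r := (path_functor c false).

Lemma sink_counit_nat (V V' : Mod C) (a : hom V V') :
  mcomp a (corner_nill false V : hom (j (r V)) V) =
  mcomp (corner_nill false V' : hom (j (r V')) V') (fmap j (fmap r a)).
Proof. exact: linear_funext. Qed.

Section Proj.
Variable M : lmodType A.

Lemma in_corner_proj (m : M) :
  in_corner (\sum_(v | is_sink v) lv K v *: m).
Proof.
move=> v vN; rewrite scaler_sumr big1 // => w ws.
rewrite scalerA lvM; case: eqP => [vw|]; last by rewrite scale0r.
by rewrite vw ws in vN.
Qed.

(** Multiplication by the idempotent e, a retraction of [M] onto eM. *)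
Definition corner_proj (m : M) : corner M :=
  @mksub _ (corner_subgroup M) _ (in_corner_proj m).

Lemma corner_projB : zmod_morphism corner_proj.
Proof.
move=> x y; apply: val_inj; rewrite raddfB /= -sumrB.
by apply: eq_bigr => v _; rewrite scalerBr.
Qed.

HB.instance Definition _ := GRing.isZmodMorphism.Build M (corner M)
  corner_proj corner_projB.

Lemma corner_proj_lv v m : corner_proj (lv K v *: m) = sink_idem K v *: corner_proj m.
Proof.
apply: val_inj; rewrite val_corner_lv /= scaler_sumr; apply: eq_bigr => w _.
by rewrite !scalerA !lvM eq_sym; case: eqP => // ->.
Qed.

Lemma corner_proj_lk k m :
  corner_proj (lk E k *: m) = sink_const E k *: corner_proj m.
Proof.
apply: val_inj; rewrite val_corner_lk /= scaler_sumr; apply: eq_bigr => w _.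
by rewrite !scalerA lk_comm.
Qed.

Lemma corner_projK (m : corner M) : corner_proj (val m) = m.
Proof.
apply: val_inj; rewrite /= -[RHS]sum_lv_scale [RHS](bigID (@is_sink E)) /=.
by rewrite [X in _ + X]big1 ?addr0 // => v /(subgP m).
Qed.

End Proj.

Lemma pfun_proj (V : lmodType C) (f : path_module c false V) :
  pfun (val (corner_proj f)) [::] = pfun f [::].
Proof.
rewrite /= pfun_sum -[RHS]scale1r -(sum_cv c) scaler_suml.
rewrite [RHS](bigID (@is_sink E)) /= [X in _ + X]big1 ?addr0.
  by apply: eq_bigr => v _; rewrite pmod_lv.
by move=> v vN; rewrite sink_idem_out // scale0r.
Qed.

Lemma corner_proj_map (M M' : lmodType A) (G : {linear M -> M'}) m :
  val (corner_proj (G m)) = G (val (corner_proj m)).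
Proof. by rewrite /= linear_sum; apply: eq_bigr => v _; rewrite linearZ_LR. Qed.

(** The map to coextend is multiplication by e followed by [h]. Uniqueness holds because a path
    function and its multiple by e agree at the empty path. *)
Lemma sink_counit_univ (M : Mod A) (V : Mod C) (h : hom (j M) V) :
  exists! g : hom M (r V),
    mcomp (corner_nill false V : hom (j (r V)) V) (fmap j g) = h.
Proof.
pose g : {additive M -> V} := (h : {linear corner M -> V}) \o @corner_proj M.
have g_v v m : g (lv K v *: m) = cv c v *: g m.
  by rewrite /g /= corner_proj_lv linearZ_LR.
have g_k k m : g (lk E k *: m) = ck c k *: g m.
  by rewrite /g /= corner_proj_lk linearZ_LR.
pose G : {linear M -> path_module c false V} := coextl (@sink_src E) g_v g_k.
exists G; split.
  by apply: linear_funext => m; rewrite -[RHS](congr1 h (corner_projK m)).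
move=> G' /linear_eq hG'; apply: linear_funext.
apply: to_path_module_eq => [|m]; first exact: sink_src.
rewrite coextl_nil -[RHS]pfun_proj corner_proj_map /g /=.
by rewrite -[LHS]hG'.
Qed.

Lemma sink_right_adjoint : left_adjoint j r.
Proof. exact: left_adjoint_counit sink_counit_nat sink_counit_univ. Qed.

Lemma sink_right_ff : fully_faithful r.
Proof.
apply: (fully_faithful_counit sink_counit_nat sink_counit_univ) => V.
exact: corner_nill_invertible.
Qed.

End Right.

End SinkAdjunctions.

(** * The kernel functor and its adjoints *)

Section CoreAdjunctions.
Variables (K : fieldType) (E : digraph).
Local Notation A := (lpa K E).
Local Notation B := (lpa K (core E)).
Local Notation T := (mem (core_vertices E)).
Implicit Types (v : vertex E) (e : edge E).
Implicit Types (w : vertex (core E)) (d : edge (core E)).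

Definition core_v v : B :=
  if insub v is Some w then lv K (w : vertex (core E)) else 0.
Definition core_e e : B :=
  if insub e is Some d then le K (d : edge (core E)) else 0.
Definition core_g e : B :=
  if insub e is Some d then lg K (d : edge (core E)) else 0.

Definition cvtx w : vertex E := val w.
Definition cedge d : edge E := val d.

Lemma src_cedge d : src (cedge d) = cvtx (src d). Proof. by []. Qed.
Lemma rng_cedge d : rng (cedge d) = cvtx (rng d). Proof. by []. Qed.

Lemma cvtx_inj : injective cvtx. Proof. exact: val_inj. Qed.
Lemma cedge_inj : injective cedge. Proof. exact: val_inj. Qed.

Lemma cvtxP w : T (cvtx w). Proof. exact: valP w. Qed.

Lemma is_cvtx v : T v -> exists w, v = cvtx w.
Proof. by move=> vT; exists (exist _ v vT). Qed.

Lemma is_cedge e : T (src e) && T (rng e) -> exists d, e = cedge d.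
Proof. by move=> eT; exists (exist _ e eT). Qed.

Lemma core_vE w : core_v (cvtx w) = lv K w.
Proof. by rewrite /core_v valK. Qed.

Lemma core_eE d : core_e (cedge d) = le K d.
Proof. by rewrite /core_e valK. Qed.

Lemma core_gE d : core_g (cedge d) = lg K d.
Proof. by rewrite /core_g valK. Qed.

Lemma core_v_out v : ~~ T v -> core_v v = 0.
Proof. by move=> vT; rewrite /core_v insubN. Qed.

Lemma core_e_out e : ~~ (T (src e) && T (rng e)) -> core_e e = 0.
Proof. by move=> eT; rewrite /core_e insubN. Qed.

Lemma core_g_out e : ~~ (T (src e) && T (rng e)) -> core_g e = 0.
Proof. by move=> eT; rewrite /core_g insubN. Qed.

Variant edge_spec e : B -> B -> Prop :=
| CoreEdge d of e = cedge d : edge_spec e (le K d) (lg K d)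
| OtherEdge of ~~ (T (src e) && T (rng e)) : edge_spec e 0 0.

Lemma edgeP e : edge_spec e (core_e e) (core_g e).
Proof.
have [eT|eT] := boolP (T (src e) && T (rng e)).
  by have [d ed] := is_cedge eT; rewrite ed core_eE core_gE; constructor.
by rewrite core_e_out ?core_g_out //; constructor.
Qed.

Variant vertex_spec v : B -> Prop :=
| CoreVertex w of v = cvtx w : vertex_spec v (lv K w)
| OtherVertex of ~~ T v : vertex_spec v 0.

Lemma vertexP v : vertex_spec v (core_v v).
Proof.
have [vT|vT] := boolP (T v).
  by have [w vw] := is_cvtx vT; rewrite vw core_vE; constructor.
by rewrite core_v_out //; constructor.
Qed.

Lemma core_vM v v' :
  core_v v * core_v v' = if v == v' then core_v v else 0.
Proof.
case: (vertexP v') => [w' ->|v'T]; last first.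
  by rewrite mulr0; case: eqP => // ->; rewrite core_v_out.
case: (vertexP v) => [w ->|vT]; last by rewrite mul0r if_same.
by rewrite lvM (inj_eq cvtx_inj).
Qed.

(** Edges of [E] leaving the core contribute zero, and the others give the relation in [core E],
    which has no sinks. *)
Lemma core_cuntz_krieger v : T v ->
  core_v v = \sum_(e | src e == v) core_e e * core_g e.
Proof.
move=> /is_cvtx[w ->]; rewrite core_vE lv_sum ?core_no_sink //.
rewrite (@sum_sub _ _ (fun e => T (src e) && T (rng e))); last first.
  by move=> e eT; rewrite core_e_out // mul0r.
apply: eq_big => d; first by rewrite -(inj_eq cvtx_inj).
by rewrite -core_eE -core_gE.
Qed.

(** The dead vertices serve as [cD]: they avoid the core, are closed under edges, and by [core_exit]
    receive every edge leaving the core. *)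
Definition core_data : corner_data K T B.
Proof.
refine (@CornerData K E T B core_v core_e core_g (@lk K (core E))
  core_v_out _ _ core_vM _ _ _ _ _ _ _ _ (@lk1 _ _) _ _ _ _ (@dead E) _ _ _).
- by move=> e eT; rewrite core_e_out // (negPf eT).
- by move=> e eT; rewrite core_g_out // (negPf eT).
- move=> e; case: edgeP => [d ->|_]; last exact: mulr0.
  by rewrite src_cedge core_vE lv_le.
- move=> e; case: edgeP => [d ->|_]; last exact: mul0r.
  by rewrite rng_cedge core_vE le_lv.
- move=> e; case: edgeP => [d ->|_]; last exact: mulr0.
  by rewrite rng_cedge core_vE lv_lg.
- move=> e; case: edgeP => [d ->|_]; last exact: mul0r.
  by rewrite src_cedge core_vE lg_lv.
- move=> e f eT; case: (edgeP e) => [d ed|eN]; last first.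
    rewrite mul0r core_v_out ?if_same //.
    by apply: contra eN => ->; rewrite eT.
  case: (edgeP f) => [d' fd|fN].
    by rewrite lg_le ed fd (inj_eq cedge_inj) rng_cedge core_vE.
  rewrite mulr0; case: eqP => // ef; case/negP: fN.
  by rewrite -ef ed src_cedge rng_cedge !cvtxP.
- by move=> v vT _; exact: core_cuntz_krieger.
- rewrite (sum_sub xpredT core_v_out) -[RHS]sum_lv.
  by apply: eq_bigr => w _; rewrite -core_vE.
- exact: lkM.
- exact: lkD.
- by move=> k v; rewrite lk_comm.
- by move=> k v; rewrite lk_comm.
- by move=> k v; rewrite lk_comm.
- exact: dead_notin_core.
- exact: dead_rng.
- exact: core_exit.
Defined.

(** The factor [a] makes the condition stable under the ring: it says that the sinks kill the whole
    submodule generated by [m]. *)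
Definition sink_free (M : lmodType A) (m : M) :=
  forall v a, is_sink v -> lv K v *: (a *: m) = 0.

Lemma sink_free_scale (M : lmodType A) (m : M) a :
  sink_free m -> sink_free (a *: m).
Proof. by move=> mZ v b vs; rewrite [b *: _]scalerA mZ. Qed.

(** The Cuntz-Krieger relation writes a dead vertex that is not a sink through the ranges of its
    edges, which are dead again; the induction ends at the sinks. *)
Lemma sink_free_dead (M : lmodType A) v (m : M) :
  dead v -> sink_free m -> lv K v *: m = 0.
Proof.
move=> vd; elim: vd m => {}v _ IH m mZ.
have [vs|vN] := boolP (is_sink v); first by rewrite -[m]scale1r mZ.
rewrite lv_sum // scaler_suml big1 // => e /eqP ev.
rewrite -scalerA -(@lv_lg K E e) -scalerA (IH e) ?scaler0 //.
exact: sink_free_scale.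
Qed.

(** In the Cuntz-Krieger relation of [E] at [w], an edge leaving the core factors through its range,
    which is dead and acts as zero here. *)
Lemma lv_core_sum (M : lmodType A) w (m : M) : sink_free m ->
  lv K (cvtx w) *: m =
  \sum_(d | src d == w) le K (cedge d) *: (lg K (cedge d) *: m).
Proof.
move=> mZ; have [e [ew _]] := core_outedge (cvtxP w).
rewrite lv_sum; last by apply/forallPn; exists e; rewrite ew negbK.
rewrite scaler_suml big_mkcond.
rewrite (@sum_sub _ _ (fun e => T (src e) && T (rng e))) => [|e' e'N].
  rewrite [RHS]big_mkcond; apply: eq_bigr => d _.
  by rewrite -scalerA -(inj_eq cvtx_inj).
case: eqP => // e'w; rewrite -scalerA -(@lv_lg K E e') -[(_ * _) *: m]scalerA.
have e'T : src e' \in core_vertices E by rewrite e'w; exact: cvtxP.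
suff -> : lv K (rng e') *: (lg K e' *: m) = 0 by rewrite scaler0.
apply: sink_free_dead; last exact: sink_free_scale.
by apply: core_exit => //; apply: contra e'N => re'; apply/andP.
Qed.

Section Object.
Variable M : lmodType A.

(* The core part of the largest submodule killed by the sinks. It is an
   L_K(core E)-module since the edges leaving the core end in dead vertices. *)
Definition in_kerpart (m : M) :=
  (forall v, ~~ T v -> lv K v *: m = 0) /\ sink_free m.

Lemma in_kerpart0 : in_kerpart 0.
Proof. by split=> [v _|v a _]; rewrite !scaler0. Qed.

Lemma in_kerpartB x y : in_kerpart x -> in_kerpart y -> in_kerpart (x - y).
Proof.
move=> [xT xZ] [yT yZ]; split=> [v vT|v a vs].
  by rewrite scalerBr xT // yT // subr0.
by rewrite !scalerBr xZ // yZ // subr0.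
Qed.

Definition kerpart := subg (Subgroup in_kerpart0 in_kerpartB).

Lemma in_kerpart_v w m : in_kerpart m -> in_kerpart (lv K (cvtx w) *: m).
Proof.
move=> [_ mZ]; split=> [v vT|]; last exact: sink_free_scale.
rewrite scalerA lvM; case: eqP => [vw|]; last by rewrite scale0r.
by rewrite vw cvtxP in vT.
Qed.

Lemma in_kerpart_e d m : in_kerpart m -> in_kerpart (le K (cedge d) *: m).
Proof.
move=> [_ mZ]; split=> [v vT|]; last exact: sink_free_scale.
rewrite scalerA lv_le_eq; case: eqP => [vw|]; last by rewrite scale0r.
by rewrite -vw src_cedge cvtxP in vT.
Qed.

Lemma in_kerpart_g d m : in_kerpart m -> in_kerpart (lg K (cedge d) *: m).
Proof.
move=> [_ mZ]; split=> [v vT|]; last exact: sink_free_scale.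
rewrite -lv_lg scalerA mulrA lvM; case: eqP => [vw|]; last by rewrite mul0r scale0r.
by rewrite vw rng_cedge cvtxP in vT.
Qed.

Lemma in_kerpart_k k m : in_kerpart m -> in_kerpart (lk E k *: m).
Proof.
move=> [mT mZ]; split=> [v vT|]; last exact: sink_free_scale.
by rewrite scalerA -lk_comm -scalerA mT // scaler0.
Qed.

Implicit Types m : kerpart.

Definition kp_v w m : kerpart :=
  @mksub _ (Subgroup in_kerpart0 in_kerpartB) _ (in_kerpart_v w (subgP m)).
Definition kp_e d m : kerpart :=
  @mksub _ (Subgroup in_kerpart0 in_kerpartB) _ (in_kerpart_e d (subgP m)).
Definition kp_g d m : kerpart :=
  @mksub _ (Subgroup in_kerpart0 in_kerpartB) _ (in_kerpart_g d (subgP m)).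
Definition kp_k k m : kerpart :=
  @mksub _ (Subgroup in_kerpart0 in_kerpartB) _ (in_kerpart_k k (subgP m)).

Lemma kp_vB w : zmod_morphism (kp_v w).
Proof. by move=> x y; apply: val_inj; exact: scalerBr. Qed.
Lemma kp_eB d : zmod_morphism (kp_e d).
Proof. by move=> x y; apply: val_inj; exact: scalerBr. Qed.
Lemma kp_gB d : zmod_morphism (kp_g d).
Proof. by move=> x y; apply: val_inj; exact: scalerBr. Qed.
Lemma kp_kB k : zmod_morphism (kp_k k).
Proof. by move=> x y; apply: val_inj; exact: scalerBr. Qed.

Lemma kp_vv w w' m : kp_v w (kp_v w' m) = if w == w' then kp_v w m else 0.
Proof.
apply: val_inj; rewrite [LHS]scalerA lvM (inj_eq cvtx_inj).
by case: ifP; rewrite ?scale0r.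
Qed.

Lemma kp_ve d m : kp_v (src d) (kp_e d m) = kp_e d m.
Proof. by apply: val_inj; rewrite [LHS]scalerA lv_le. Qed.
Lemma kp_ev d m : kp_e d (kp_v (rng d) m) = kp_e d m.
Proof. by apply: val_inj; rewrite [LHS]scalerA le_lv. Qed.
Lemma kp_vg d m : kp_v (rng d) (kp_g d m) = kp_g d m.
Proof. by apply: val_inj; rewrite [LHS]scalerA lv_lg. Qed.
Lemma kp_gv d m : kp_g d (kp_v (src d) m) = kp_g d m.
Proof. by apply: val_inj; rewrite [LHS]scalerA lg_lv. Qed.

Lemma kp_ge d d' m : kp_g d (kp_e d' m) = if d == d' then kp_v (rng d) m else 0.
Proof.
apply: val_inj; rewrite [LHS]scalerA lg_le (inj_eq cedge_inj).
by case: ifP; rewrite ?scale0r.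
Qed.

Lemma kp_sum w m : ~~ is_sink w ->
  kp_v w m = \sum_(d | src d == w) kp_e d (kp_g d m).
Proof.
move=> _; apply: val_inj; rewrite [RHS]raddf_sum.
by apply: lv_core_sum; case: (subgP m).
Qed.

Lemma sum_kp m : \sum_w kp_v w m = m.
Proof.
apply: val_inj; rewrite raddf_sum -[RHS]sum_lv_scale.
have [mT _] := subgP m.
by rewrite (@sum_sub _ _ T xpredT (fun v => lv K v *: val m) mT).
Qed.

Lemma kp_kA a b m : kp_k a (kp_k b m) = kp_k (a * b) m.
Proof. by apply: val_inj; rewrite [LHS]scalerA lkM. Qed.
Lemma kp_k1 m : kp_k 1 m = m.
Proof. by apply: val_inj; rewrite /= lk1 scale1r. Qed.
Lemma kp_kD a b m : kp_k (a + b) m = kp_k a m + kp_k b m.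
Proof. by apply: val_inj; rewrite /= lkD scalerDl. Qed.
Lemma kp_kv k w m : kp_k k (kp_v w m) = kp_v w (kp_k k m).
Proof. by apply: val_inj; rewrite /= !scalerA lk_comm. Qed.
Lemma kp_ke k d m : kp_k k (kp_e d m) = kp_e d (kp_k k m).
Proof. by apply: val_inj; rewrite /= !scalerA lk_comm. Qed.
Lemma kp_kg k d m : kp_k k (kp_g d m) = kp_g d (kp_k k m).
Proof. by apply: val_inj; rewrite /= !scalerA lk_comm. Qed.

Definition kp_rep : lpa_rep K (core E) kerpart :=
  LpaRep kp_vB kp_eB kp_gB kp_kB kp_vv kp_ve kp_ev kp_vg kp_gv kp_ge
    kp_sum sum_kp kp_kA kp_k1 kp_kD kp_kv kp_ke kp_kg.

Definition kp_module : lmodType B := rep_module_of kp_rep.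

Definition kp_val (m : kp_module) : M := val (m : kerpart).

Lemma kp_valB : zmod_morphism kp_val.
Proof. exact: (raddfB (val : kerpart -> M)). Qed.

HB.instance Definition _ := GRing.isZmodMorphism.Build kp_module M kp_val kp_valB.

Lemma kp_val_inj : injective kp_val.
Proof. exact: val_inj. Qed.

Lemma kp_valP (m : kp_module) : in_kerpart (kp_val m).
Proof. exact: (subgP (m : kerpart)). Qed.

Lemma kp_val_v w (m : kp_module) : kp_val (lv K w *: m) = lv K (cvtx w) *: kp_val m.
Proof. by rewrite (@rep_lv _ _ _ kp_rep w m). Qed.

Lemma kp_val_e d (m : kp_module) : kp_val (le K d *: m) = le K (cedge d) *: kp_val m.
Proof. by rewrite (@rep_le _ _ _ kp_rep d m). Qed.

Lemma kp_val_g d (m : kp_module) : kp_val (lg K d *: m) = lg K (cedge d) *: kp_val m.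
Proof. by rewrite (@rep_lg _ _ _ kp_rep d m). Qed.

Lemma kp_val_k k (m : kp_module) : kp_val (lk (core E) k *: m) = lk E k *: kp_val m.
Proof. by rewrite (@rep_lk _ _ _ kp_rep k m). Qed.

Definition kp_mk (m : M) (mP : in_kerpart m) : kp_module :=
  @mksub _ (Subgroup in_kerpart0 in_kerpartB) _ mP.

Section Factor.
Variables (N : lmodType B) (f : {additive N -> M}).
Hypothesis fP : forall n, in_kerpart (f n).
Hypothesis f_v : forall w n, f (lv K w *: n) = lv K (cvtx w) *: f n.
Hypothesis f_e : forall d n, f (le K d *: n) = le K (cedge d) *: f n.
Hypothesis f_g : forall d n, f (lg K d *: n) = lg K (cedge d) *: f n.
Hypothesis f_k : forall k n, f (lk (core E) k *: n) = lk E k *: f n.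

Definition kp_factor0 (n : N) : kp_module := kp_mk (fP n).

Lemma kp_factor0B : zmod_morphism kp_factor0.
Proof. by move=> x y; apply: kp_val_inj; rewrite raddfB /= [LHS]raddfB. Qed.

HB.instance Definition _ := GRing.isZmodMorphism.Build N kp_module
  kp_factor0 kp_factor0B.

Lemma kp_factor_linear : linear kp_factor0.
Proof.
apply: lpa_linear => [w n|d n|d n|k n]; apply: kp_val_inj.
- by rewrite kp_val_v; exact: f_v.
- by rewrite kp_val_e; exact: f_e.
- by rewrite kp_val_g; exact: f_g.
- by rewrite kp_val_k; exact: f_k.
Qed.

Definition kp_factor : {linear N -> kp_module} := mklin kp_factor_linear.

End Factor.

End Object.

Section Map.
Variables (M M' : lmodType A) (h : {linear M -> M'}).

Lemma in_kerpart_map (m : M) : in_kerpart m -> in_kerpart (h m).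
Proof.
move=> [mT mZ]; split=> [v vT|v a vs].
  by rewrite -linearZ_LR mT // linear0.
by rewrite -!linearZ_LR mZ // linear0.
Qed.

Definition kp_map : {linear kp_module M -> kp_module M'}.
Proof.
refine (@kp_factor M' (kp_module M) (h \o @kp_val M : {additive _ -> _})
  (fun m => in_kerpart_map (kp_valP m)) _ _ _ _) => [w n|d n|d n|k n] /=.
- by rewrite kp_val_v linearZ_LR.
- by rewrite kp_val_e linearZ_LR.
- by rewrite kp_val_g linearZ_LR.
- by rewrite kp_val_k linearZ_LR.
Defined.

End Map.

Lemma kp_map1 (M : Mod A) : kp_map (idm M) = idm (kp_module M : Mod B).
Proof. by apply: linear_funext => m; apply: kp_val_inj. Qed.

Lemma kp_mapM (M M' M'' : Mod A) (g : hom M' M'') (h : hom M M') :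
  kp_map (mcomp g h) = mcomp (kp_map g : @hom (Mod B) _ _) (kp_map h).
Proof. by apply: linear_funext => m; apply: kp_val_inj. Qed.

Definition kp_functor : functor (Mod A) (Mod B) :=
  @Functor (Mod A) (Mod B) kp_module kp_map kp_map1 kp_mapM.

End CoreAdjunctions.

(** * The embedding of L_K(core E)-modules and its right adjoint *)

Section KernelAdjunctions.
Variables (K : fieldType) (E : digraph).
Local Notation A := (lpa K E).
Local Notation B := (lpa K (core E)).
Local Notation T := (mem (core_vertices E)).
Local Notation c := (core_data K E).
Local Notation p := (kp_functor K E).
Local Notation i := (path_functor c true).
Implicit Types (v : vertex E) (e : edge E).

(** A sink is dead, hence outside the core, and starts no edge; so no path to the core begins at a
    sink. *)
Lemma path_module_sink_free (N : lmodType B) (f : path_module c true N) :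
  sink_free f.
Proof.
move=> v a vs; rewrite pmod_lv; apply: pspaceP => -[|e es].
  rewrite pfun_v pfun0 /= core_v_out ?scale0r //.
  by apply: dead_notin_core; exact: dead_sink.
rewrite pfun_v pfun0 /=; case: eqP => // ev.
by have := sink_src e; rewrite ev vs.
Qed.

Section Unit.
Variable N : lmodType B.
Local Notation iN := (path_module c true N).

Lemma in_kerpart_inc (n : N) : in_kerpart (ps_inc c true n : iN).
Proof.
split=> [v vT|]; last exact: path_module_sink_free.
rewrite pmod_lv -ps_inc_v (cv_out c vT) scale0r.
by apply: pspaceP => -[|e es]; rewrite pfun_inc pfun0.
Qed.

Definition core_inc : N -> iN := @ps_inc _ _ _ _ c true N.
HB.instance Definition _ := GRing.isZmodMorphism.Build N iN core_inc
  (@ps_inc_B _ _ _ _ c true N).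

Definition kp_inc : {linear N -> kp_module iN}.
Proof.
refine (@kp_factor K E iN N (core_inc : {additive _ -> _})
  in_kerpart_inc _ _ _ _) => [w n|d n|d n|k n].
- by rewrite pmod_lv -core_vE; exact: (ps_inc_v c).
- by rewrite pmod_le -core_eE; apply: (ps_inc_e c); exact: cvtxP (src d).
- by rewrite pmod_lg -core_gE; exact: (ps_inc_g c).
- by rewrite pmod_lk; exact: (ps_inc_k c).
Defined.

Lemma kp_incE n : kp_val (kp_inc n) = ps_inc c true n.
Proof. by []. Qed.

Lemma kp_inc_invertible : @invertible (Mod B) _ _ kp_inc.
Proof.
apply: invertible_linear => [n n' /(congr1 (@kp_val K E iN))|f].
  by move=> /(congr1 (fun f : pspace c true N => pfun f [::])).
exists (pfun (kp_val f) [::]); apply: kp_val_inj; rewrite kp_incE.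
rewrite [RHS](corner_inc (f := kp_val f)) // => v vN.
by rewrite -pmod_lv; case: (kp_valP f) => ->.
Qed.

End Unit.

Lemma kp_unit_nat (N N' : Mod B) (a : hom N N') :
  mcomp (kp_inc N' : hom N' (p (i N'))) a =
  mcomp (fmap p (fmap i a)) (kp_inc N).
Proof.
apply: linear_funext => n; apply: kp_val_inj.
exact: (esym (ps_map_inc c true a n)).
Qed.

Section Extend.
Variables (N : lmodType B) (M : lmodType A) (h : {linear N -> kp_module M}).
Definition kp_add : {additive N -> M} := @kp_val K E M \o h.

Lemma kp_addE n : kp_add n = kp_val (h n).
Proof. by []. Qed.

Lemma kp_add_v v n : kp_add (cv c v *: n) = lv K v *: kp_add n.
Proof.
rewrite !kp_addE linearZ_LR -[cv c v]/(core_v K v).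
case: (vertexP K v) => [w ->|vT].
  exact: kp_val_v.
by rewrite scale0r raddf0; case: (kp_valP (h n)) => ->.
Qed.

(** If [e] leaves the core, both sides vanish: [e] factors on the right through its range, which
    kills the core part. *)
Lemma kp_add_e e n : T (src e) -> kp_add (ce c e *: n) = le K e *: kp_add n.
Proof.
move=> eT; rewrite !kp_addE linearZ_LR -[ce c e]/(core_e K e).
case: (edgeP K e) => [d ->|eN].
  exact: kp_val_e.
rewrite scale0r raddf0 -le_lv -scalerA; case: (kp_valP (h n)) => -> //.
  by rewrite scaler0.
by apply: contra eN => re; apply/andP.
Qed.

(** A ghost edge has the range on its left, so being in the core part is no help; the range of an
    edge leaving the core is dead and acts as zero on sink-free elements. *)
Lemma kp_add_g e n : T (src e) -> kp_add (cg c e *: n) = lg K e *: kp_add n.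
Proof.
move=> eT; rewrite !kp_addE linearZ_LR -[cg c e]/(core_g K e).
case: (edgeP K e) => [d ->|eN].
  exact: kp_val_g.
have [_ hZ] := kp_valP (h n).
rewrite scale0r raddf0 -lv_lg -scalerA; symmetry; apply: sink_free_dead.
  by apply: core_exit => //; apply: contra eN => re; apply/andP.
exact: sink_free_scale.
Qed.

Lemma kp_add_k k n : kp_add (ck c k *: n) = lk E k *: kp_add n.
Proof. by rewrite !kp_addE linearZ_LR; exact: kp_val_k. Qed.

Definition kp_ext : {linear path_module c true N -> M} :=
  extl (@pspace_bounded _ _ _ _ c N) kp_add_v kp_add_e kp_add_g kp_add_k.

Lemma kp_ext_inc n : kp_ext (ps_inc c true n) = kp_val (h n).
Proof. exact (extl_inc _ kp_add_v kp_add_e kp_add_g kp_add_k n). Qed.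

End Extend.

Lemma kp_unit_univ (N : Mod B) (M : Mod A) (h : hom N (p M)) :
  exists! g : hom (i N) M,
    mcomp (fmap p g) (kp_inc N : hom N (p (i N))) = h.
Proof.
exists (kp_ext h); split.
  apply: linear_funext => n; apply: (@kp_val_inj _ _ M).
  exact (kp_ext_inc h n).
move=> G' /linear_eq hG'; apply: linear_funext.
apply: path_module_eq => [|n]; first exact: pspace_bounded.
by rewrite kp_ext_inc -hG'.
Qed.

Lemma kp_left_adjoint : left_adjoint i p.
Proof. exact: left_adjoint_unit kp_unit_nat kp_unit_univ. Qed.

Lemma kp_left_ff : fully_faithful i.
Proof.
apply: (fully_faithful_unit kp_unit_nat kp_unit_univ) => N.
exact: kp_inc_invertible.
Qed.

Definition kp_counit (M : Mod A) : @hom (Mod A) (i (p M)) M :=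
  kp_ext (idfun : {linear kp_module M -> kp_module M}).

Lemma kp_counit_inc (M : Mod A) n : kp_counit M (ps_inc c true n) = kp_val n.
Proof. exact: kp_ext_inc. Qed.

Lemma kp_counit_nat (M M' : Mod A) (h : hom M M') :
  mcomp h (kp_counit M) = mcomp (kp_counit M') (fmap i (fmap p h)).
Proof.
apply: linear_funext; apply: path_module_eq => [|n]; first exact: pspace_bounded.
rewrite -[LHS]/(h (kp_counit M (ps_inc c true n))).
rewrite -[RHS]/(kp_counit M' (ps_map (c := c) (kp_map h) (ps_inc c true n))).
by rewrite ps_map_inc !kp_counit_inc.
Qed.

(** Injectivity comes from [extl_inj], the core part being embedded in [M]. The image is a
    submodule, so surjectivity reduces to the elements v x, which are reached by induction from the
    core and the sinks. *)
Lemma kp_counit_invertible (M : Mod A) :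
  (forall m : (M : lmodType A), sink_free m) -> invertible (kp_counit M).
Proof.
move=> MZ; apply: invertible_linear.
  by apply: extl_inj; exact: kp_val_inj.
move=> m; rewrite -[m]sum_lv_scale.
pose I := imsub (kp_counit M : {linear path_module c true _ -> M}).
have I0 : I 0 := subgroup0 I.
have ID x y : I x -> I y -> I (x + y).
  move=> Ix Iy; rewrite -[y]opprK -[- y]sub0r.
  by do 2! [apply: subgroupB => //].
suff Iv v (x : (M : lmodType A)) : I (lv K v *: x).
  by elim/big_ind: _ => // v _; exact: Iv.
elim/core_ind: v x => v vT.
  move=> x; have [w vw] := is_cvtx vT.
  have xP : in_kerpart (lv K v *: x).
    split=> [u uT|]; last exact: MZ.
    rewrite scalerA lvM; case: eqP => [uv|]; last by rewrite scale0r.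
    by move: uT; rewrite uv /= vT.
  by exists (ps_inc c true (kp_mk xP)); rewrite kp_counit_inc.
move=> IH x; have [vs|vN] := boolP (is_sink v).
  by rewrite -[x]scale1r MZ.
(* Each Cuntz-Krieger summand is an edge applied to a multiple of its range, and the latter is in
   the image by induction. *)
rewrite lv_sum // scaler_suml; elim/big_ind: _ => // e /eqP ev.
rewrite -scalerA -lv_lg -scalerA; apply: submoduleZ; exact: IH.
Qed.

End KernelAdjunctions.

(** * The left adjoint of the embedding, and the essential image *)

Definition functor_comp (C D D' : category) (G : functor D D')
    (F : functor C D) : functor C D'.
Proof.
refine (@Functor C D' (fun X => G (F X)) (fun X Y f => fmap G (fmap F f)) _ _).
- by move=> X; rewrite !fmap1.
- by move=> X Y Z g f; rewrite !fmapM.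
Defined.

Section SinkQuotient.
Variables (K : fieldType) (E : digraph).
Local Notation A := (lpa K E).
Local Notation B := (lpa K (core E)).
Local Notation c := (core_data K E).
Local Notation p := (kp_functor K E).
Local Notation i := (path_functor c true).

Section Object.
Variable M : lmodType A.

(** The submodule generated by the multiples of sinks, as an intersection. *)
Definition in_sink_span (m : M) := forall U : submodule M,
  (forall v x, is_sink v -> U (lv K v *: x)) -> U m.

Lemma sink_span0 : in_sink_span 0.
Proof. by move=> U _; exact: subgroup0. Qed.

Lemma sink_spanB x y :
  in_sink_span x -> in_sink_span y -> in_sink_span (x - y).
Proof. by move=> xS yS U US; apply: subgroupB; [exact: xS|exact: yS]. Qed.

Lemma sink_spanZ a x : in_sink_span x -> in_sink_span (a *: x).
Proof. by move=> xS U US; apply: submoduleZ; exact: xS. Qed.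

Definition sink_span : submodule M :=
  @Submodule _ _ (Subgroup sink_span0 sink_spanB) sink_spanZ.

End Object.

Lemma sink_quotient_free (M : lmodType A) (m : quom (sink_span M)) : sink_free m.
Proof.
move=> v a vs; have [x <-] := quom_pi_surj m.
rewrite -[a *: _](linearZ_LR (quom_proj (sink_span M))).
rewrite -[LHS](linearZ_LR (quom_proj (sink_span M))).
by apply/quom_pi_eq0 => U US; exact: US.
Qed.

Lemma sink_span_kill (M M' : lmodType A) (h : {linear M -> M'}) :
  (forall m : M', sink_free m) -> forall m, sink_span M m -> h m = 0.
Proof.
move=> M'Z m mS; apply: (mS (kersub h)) => v x vs /=.
by rewrite linearZ_LR -[h x]scale1r M'Z.
Qed.

Section Map.
Variables (M M' : lmodType A) (h : {linear M -> M'}).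

Lemma sink_quotient_kill m :
  sink_span M m -> (quom_proj (sink_span M') \o h : {linear _ -> _}) m = 0.
Proof. by apply: sink_span_kill; exact: sink_quotient_free. Qed.

Definition sink_quotient_map :
  {linear quom (sink_span M) -> quom (sink_span M')} :=
  quom_lin sink_quotient_kill.

Lemma sink_quotient_mapE m :
  sink_quotient_map (quom_proj _ m) = quom_proj _ (h m).
Proof. exact: (quom_liftE sink_quotient_kill). Qed.

End Map.

Lemma quom_ext (M M' : lmodType A) (U : submodule M)
    (f g : {linear quom U -> M'}) :
  (forall m, f (quom_proj U m) = g (quom_proj U m)) -> f = g.
Proof.
by move=> fg; apply: linear_funext => y; have [x <-] := quom_pi_surj y; exact: fg.
Qed.

Lemma sink_quotient_map1 (M : Mod A) :
  sink_quotient_map (idm M) = idm (quom (sink_span M) : Mod A).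
Proof. by apply: quom_ext => m; rewrite sink_quotient_mapE. Qed.

Lemma sink_quotient_mapM (M M' M'' : Mod A) (g : hom M' M'') (h : hom M M') :
  sink_quotient_map (mcomp g h) =
  mcomp (sink_quotient_map g : @hom (Mod A) _ _) (sink_quotient_map h).
Proof.
apply: quom_ext => m; rewrite sink_quotient_mapE.
rewrite -[RHS]/(sink_quotient_map g (sink_quotient_map h (quom_proj _ m))).
by rewrite !sink_quotient_mapE.
Qed.

Definition sink_quotient_functor : functor (Mod A) (Mod A) :=
  @Functor (Mod A) (Mod A) (fun M => quom (sink_span M)) sink_quotient_map
    sink_quotient_map1 sink_quotient_mapM.

Local Notation Q := sink_quotient_functor.
Local Notation q := (functor_comp p Q).

Lemma Q_counit_invertible (M : Mod A) : invertible (kp_counit (Q M)).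
Proof. by apply: kp_counit_invertible => m; exact: sink_quotient_free. Qed.

Definition Q_counit_inv (M : Mod A) : hom (Q M) (i (p (Q M))) :=
  projT1 (cid (Q_counit_invertible M)).

Lemma Q_counit_invK M :
  mcomp (Q_counit_inv M) (kp_counit (Q M)) = idm _ /\
  mcomp (kp_counit (Q M)) (Q_counit_inv M) = idm _.
Proof. by rewrite /Q_counit_inv; case: cid. Qed.

Definition Q_proj (M : Mod A) : hom M (Q M) := quom_proj (sink_span M).

(** The largest sink-free quotient of [M] is recovered from its core part through the counit of (i,
    p). *)
Definition q_unit (M : Mod A) : hom M (i (q M)) :=
  mcomp (Q_counit_inv M) (Q_proj M).

Lemma Q_proj_nat (M M' : Mod A) (a : hom M M') :
  mcomp (Q_proj M') a = mcomp (fmap Q a) (Q_proj M).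
Proof.
by apply: linear_funext => m; exact: (esym (sink_quotient_mapE a m)).
Qed.

Lemma q_unit_nat (M M' : Mod A) (a : hom M M') :
  mcomp (q_unit M') a = mcomp (fmap i (fmap q a)) (q_unit M).
Proof.
have [e1 e2] := Q_counit_invK M; have [e1' e2'] := Q_counit_invK M'.
rewrite /q_unit -mcompA Q_proj_nat !mcompA; congr (mcomp _ _).
(* Inserting the counit after its inverse reduces the claim to the naturality of the counit. *)
rewrite -[LHS]mcompm1 -e2 !mcompA -[mcomp (mcomp _ _) (kp_counit _)]mcompA.
by rewrite kp_counit_nat mcompA e1' mcomp1m.
Qed.

(** As i N is sink-free, [f] factors uniquely through Q M, which is isomorphic to i (q M); full
    faithfulness of i then lifts the factor to a map from q M to [N]. *)
Lemma q_unit_univ (M : Mod A) (N : Mod B) (f : hom M (i N)) :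
  exists! g : hom (q M) N, mcomp (fmap i g) (q_unit M) = f.
Proof.
have [e1 e2] := Q_counit_invK M.
have fS := sink_span_kill f (@path_module_sink_free K E N).
pose f' : hom (Q M) (i N) := quom_lin fS.
have f'E : mcomp f' (Q_proj M) = f.
  by apply: linear_funext => m; exact: (quom_liftE fS).
have Qepi (h h' : hom (Q M) (i N)) :
    mcomp h (Q_proj M) = mcomp h' (Q_proj M) -> h = h'.
  by move=> /linear_eq hh'; apply: quom_ext => m; exact: hh'.
have [i' iK i'K] := kp_left_ff (K := K) (q M) N.
exists (i' (mcomp f' (kp_counit (Q M)))); split.
  by rewrite i'K /q_unit mcompA -(mcompA f') e2 mcompm1.
move=> g ge; apply: (can_inj iK); rewrite i'K.
rewrite -f'E /q_unit mcompA in ge; rewrite -(Qepi _ _ ge).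
by rewrite -mcompA e1 mcompm1.
Qed.

Lemma q_left_adjoint : left_adjoint q i.
Proof. exact: left_adjoint_unit q_unit_nat q_unit_univ. Qed.

Local Notation j := (corner_functor K E).

(** Multiples of sinks lie in the corner, and every element of the corner is a sum of such
    multiples. *)
Lemma sink_free_kernel (M : Mod A) :
  functor_kernel j M <-> forall m : (M : lmodType A), sink_free m.
Proof.
split=> [[Z [/trivial_zero_object Z0 [f [g [gf _]]]]] m v a vs|MZ].
  have vC : in_corner (lv K v *: (a *: m)).
    by move=> u uN; rewrite scalerA lvM; case: eqP uN => [-> /negP|_ _];
      rewrite ?scale0r.
  pose x : corner M := mksub (U := corner_subgroup M) vC.
  have gfx : g (f x) = x := linear_eq gf x.
  by rewrite -[LHS]/(val x) -gfx [f x]Z0 linear0.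
have jM0 (m : corner M) : m = 0.
  apply: val_inj; rewrite -[LHS]sum_lv_scale big1 // => v _.
  have [vs|vN] := boolP (is_sink v); last exact: (subgP m).
  by rewrite -[val m]scale1r MZ.
exists (j M); split; first exact: zero_object_trivial.
by exists (idm _), (idm _); rewrite !mcomp1m.
Qed.

(** Both sides amount to sink-freeness: it holds in path modules and transfers along isomorphisms,
    and it makes the counit i (p M) -> M invertible. *)
Lemma image_kernel (M : Mod A) : essential_image i M <-> functor_kernel j M.
Proof.
rewrite sink_free_kernel; split=> [[N [f [g [_ fg]]]] m|MZ].
  move=> v a vs; have fgm : f (g m) = m := linear_eq fg m.
  have gm0 := path_module_sink_free (g m) a vs.
  transitivity (f (lv K v *: (a *: (g m : path_module c true N)))).
    by rewrite !linearZ_LR [f _]fgm.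
  by rewrite [X in f X]gm0 linear0.
have [g [gK Kg]] := kp_counit_invertible MZ.
by exists (p M), (kp_counit M), g.
Qed.

End SinkQuotient.

Theorem corollary2 (K : fieldType) (E : digraph) :
  inhabited (recollement (Mod (lpa K (core E))) (Mod (lpa K E))
                         (Mod {ffun sinks E -> K})).
Proof.
constructor.
exact: (Recollement (Mod_abelian _) (Mod_abelian _) (Mod_abelian _)
  (sink_left_adjoint K E) (sink_right_adjoint K E) (q_left_adjoint K E)
  (kp_left_adjoint K E) (@kp_left_ff K E) (@sink_left_ff K E)
  (@sink_right_ff K E) (@image_kernel K E)).
Qed.
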